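(* For each uniform reflection group $\Gamma=\langle g_1,\ldots,g_N\rangle$ with $\mathbb Z_2^{*N}\to\Gamma\to\mathbb Z_2^N$, let $S^{N-1}_\Gamma\subset S^{N-1}_{\mathbb R,+}$ be the noncommutative sphere such that $C(S^{N-1}_\Gamma)$ is the quotient of $C(S^{N-1}_{\mathbb R,+})$ by the relations $$x_{i_1}\cdots x_{i_k}=x_{j_1}\cdots x_{j_k},$$ imposed for all $k$ and all multi-indices $i,j\in\{1,\ldots,N\}^k$ with $\ker\binom{i}{j}\in P_{vert}$ and $g_{i_1}\cdots g_{i_k}=g_{j_1}\cdots g_{j_k}$ in $\Gamma$. Then $\widehat\Gamma\leftrightarrow S^{N-1}_\Gamma$ is a one-to-one correspondence (duality) between the noncommutative cubes and the noncommutative spheres associated to such groups $\Gamma$, the inverse construction being $$\widehat\Gamma=S^{N-1}_\Gamma\cap\widehat{\mathbb Z_2^{*N}}.$$ There is as well a twisted correspondence $\widehat\Gamma\leftrightarrow\bar S^{N-1}_\Gamma$, obtained similarly, by using instead, for the same pairs $(i,j)$, the relations $x_{i_1}\cdots x_{i_k}=\varepsilon\left(\ker\binom{i}{j}\right)x_{j_1}\cdots x_{j_k}$.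
   Context: A reflection group $\Gamma=\langle g_1,\ldots,g_N\rangle$ is a group with generators satisfying $g_i^2=1$; the notation $\mathbb Z_2^{*N}\to\Gamma\to\mathbb Z_2^N$ means that there are quotient maps sending standard generators to standard generators. It is uniform if each permutation $\sigma\in S_N$ produces a group automorphism $g_i\to g_{\sigma(i)}$. The free real sphere is defined by $C(S^{N-1}_{\mathbb R,+})=C^*(x_1,\ldots,x_N\mid x_i=x_i^*,\ x_1^2+\cdots+x_N^2=1)$ (universal $C^*$-algebra). A closed subset $X\subset S^{N-1}_{\mathbb R,+}$ corresponds to a quotient $C^*$-algebra $C(X)$ of $C(S^{N-1}_{\mathbb R,+})$; the intersection $X\cap Y$ corresponds to the quotient by the relations of both $X$ and $Y$. The noncommutative cube $\widehat\Gamma$ is the dual of $\Gamma$, given by $C(\widehat\Gamma)=C^*(\Gamma)$ (full group algebra), and is viewed as a closed subset of $S^{N-1}_{\mathbb R,+}$ via $x_i=g_i/\sqrt N$. $P(k,l)$ is the set of partitions of a set of $k$ upper and $l$ lower points (legs). $\ker\binom{i}{j}$ is the partition of the $k$ upper and $l$ lower points obtained by joining equal indices of $i$ (upper row) and $j$ (lower row). $P_{even}$ is the set of partitions with all blocks of even size; $P_{vert}\subset P_{even}$ is the set of partitions in which each block has the same number of upper and lower legs. So $\ker\binom{i}{j}\in P_{vert}$ means that each index occurs equally often in $i$ and $j$. The signature $\varepsilon:P_{even}\to\{-1,1\}$ is $\varepsilon(\pi)=(-1)^c$, with $c$ the number (well defined modulo $2$) of switches between neighboring legs, in the same row and belonging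 to different blocks, required for making $\pi$ noncrossing. *)

(* Defs.v *)
From HB Require Import structures.
From mathcomp Require Import all_boot all_order all_algebra all_fingroup.
From mathcomp Require Import complex.
From mathcomp Require Import all_classical all_reals all_analysis.
Import Order.TTheory GRing.Theory Num.Theory.
Import numFieldNormedType.Exports.

Set Implicit Arguments.
Unset Strict Implicit.
Unset Printing Implicit Defensive.

Local Open Scope ring_scope.
Local Open Scope classical_set_scope.

(* [inl a] is the a-th upper leg, [inr b] the b-th lower leg (from left to
   right); partitions are sets of blocks, as in [finset.partition]. *)
Notation leg k l := ('I_k + 'I_l)%type.

Section Partitions.
Local Open Scope nat_scope.
Variables k l : nat.
Implicit Types (P Q : {set {set leg k l}}) (p q : leg k l).

Definition Pvert P : bool :=
  finset.partition P finset.setT &&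
  [forall B in P, #|[set a : 'I_k | inl a \in B]%SET|
               == #|[set b : 'I_l | inr b \in B]%SET|].

(* Position on the boundary circle, read clockwise from the upper left leg. *)
Definition leg_pos p : nat :=
  match p with inl a => a | inr b => k + (l - b.+1) end.

Definition noncrossing P : bool :=
  [forall B in P, forall C in P, (B != C) ==>
    ~~ [exists a in B, exists b in C, exists c in B, exists d in C,
        [&& leg_pos a < leg_pos b, leg_pos b < leg_pos c
          & leg_pos c < leg_pos d]]].

Definition neighbors p q : bool :=
  match p, q with
  | inl a, inl b => b == a.+1 :> nat
  | inr a, inr b => b == a.+1 :> nat
  | _, _ => false
  end.

Definition switch : rel {set {set leg k l}} := fun P Q =>
  [exists p, exists q,
    [&& neighbors p q, finset.pblock P p != finset.pblock P q
      & Q == [set tperm p q @: B | B : {set leg k l} in P]%SET]].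

Definition noncrossing_after P (c : nat) : Prop :=
  exists s : seq {set {set leg k l}},
    [/\ path switch P s, size s = c & noncrossing (last P s)].

(* Any c with [noncrossing_after P c] is used: its parity depends only on P
   when all blocks of P have even size. *)
Definition signature P : int := (-1) ^+ xget 0 (noncrossing_after P).

Definition kernel (N : nat) (i : k.-tuple 'I_N) (j : l.-tuple 'I_N) :
    {set {set leg k l}} :=
  preim_partition
    (fun p => match p with inl a => tnth i a | inr b => tnth j b end)
    finset.setT.

End Partitions.

(* Z_2^{*N} as the group of reduced words in the N generators. *)
Section FreeProduct.
Variable N : nat.

Definition reduced (w : seq 'I_N) : bool := sorted (fun a b => a != b) w.

Record Z2star : Type := Z2Star { word : seq 'I_N; _ : reduced word }.
HB.instance Definition _ := [isSub for word].
HB.instance Definition _ := [Choice of Z2star by <:].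

Definition push (a : 'I_N) (w : seq 'I_N) : seq 'I_N :=
  if w is b :: w' then if a == b then w' else a :: w else [:: a].

Lemma reduced_push a w : reduced w -> reduced (push a w).
Proof.
case: w => [|b w] //= rw; case: eqP => [_|/eqP ab]; last by rewrite /= ab.
exact: path_sorted rw.
Qed.

Lemma reduced_foldr_push u v : reduced v -> reduced (foldr push v u).
Proof. by move=> rv; elim: u => //= a u IH; apply: reduced_push. Qed.

Lemma pushK a w : reduced w -> push a (push a w) = w.
Proof.
case: w => [|b w] /=; first by rewrite eqxx.
case: eqP => [<-|_ _] /=; last by rewrite eqxx.
by case: w => //= c w /andP[/negPf->].
Qed.

Lemma foldr_push w v z : reduced v -> reduced z ->
  foldr push z (foldr push v w) = foldr push (foldr push z v) w.
Proof.
move=> rv rz; elim: w => //= a w <-.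
have := reduced_foldr_push w rv; case: (foldr push v w) => //= b t rt.
case: eqP => // <-; rewrite pushK //; exact: reduced_foldr_push.
Qed.

Lemma foldr_push_nil w : reduced w -> foldr push [::] w = w.
Proof.
elim: w => //= a w IH rw; rewrite IH; last exact: path_sorted rw.
by case: w rw {IH} => //= b w /andP[/negPf->].
Qed.

Lemma reduced_rev w : reduced w -> reduced (rev w).
Proof.
rewrite /reduced rev_sorted; apply: sub_sorted => a b; by rewrite eq_sym.
Qed.

Lemma foldr_push_rev w v : reduced v -> foldr push (foldr push v w) (rev w) = v.
Proof.
elim: w v => //= a w IH v rv; rewrite rev_cons foldr_rcons pushK ?IH //.
exact: reduced_foldr_push.
Qed.

Definition Z2star_mul (u v : Z2star) : Z2star :=
  Z2Star (reduced_foldr_push (word u) (valP v)).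
Definition Z2star_one : Z2star := @Z2Star [::] isT.
Definition Z2star_inv (u : Z2star) : Z2star := Z2Star (reduced_rev (valP u)).

Fact Z2star_mulA : associative Z2star_mul.
Proof.
by move=> u v w; apply: val_inj; rewrite /= foldr_push ?(valP w) ?(valP v).
Qed.
Fact Z2star_mul1 : left_id Z2star_one Z2star_mul.
Proof. by move=> u; apply: val_inj. Qed.
Fact Z2star_mulr1 : right_id Z2star_one Z2star_mul.
Proof. by move=> u; apply: val_inj; rewrite /= foldr_push_nil ?(valP u). Qed.
Fact Z2star_mulV : left_inverse Z2star_one Z2star_inv Z2star_mul.
Proof.
move=> u; apply: val_inj => /=.
by rewrite -[X in foldr _ X _](foldr_push_nil (valP u)) foldr_push_rev.
Qed.
Fact Z2star_mulrV : right_inverse Z2star_one Z2star_inv Z2star_mul.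
Proof.
move=> u; apply: val_inj => /=.
rewrite -[X in foldr _ _ X]revK.
by rewrite -[X in foldr _ X _](foldr_push_nil (reduced_rev (valP u)))
  foldr_push_rev.
Qed.

HB.instance Definition _ := isGroup.Build Z2star
  Z2star_mulA Z2star_mul1 Z2star_mulr1 Z2star_mulV Z2star_mulrV.

Definition Z2star_gen (i : 'I_N) : Z2star := @Z2Star [:: i] isT.

End FreeProduct.

(* The relations g_i^2 = 1 and the generation of G by the g_i are contained in
   the existence of the quotient map Z_2^{*N} -> G.  The group Z_2^N is the
   additive group of row vectors over F_2, its generators being the unit
   vectors. *)
Definition reflection_group (N : nat) (G : groupType) (g : 'I_N -> G) : Prop :=
  (exists p : Z2star N -> G,
     [/\ {morph p : a b / (a * b)%g}, set_surj setT setT p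
       & forall i, p (Z2star_gen i) = g i]) /\
  (exists q : G -> 'rV['F_2]_N,
     [/\ {morph q : a b / (a * b)%g >-> a + b}, set_surj setT setT q
       & forall i, q (g i) = delta_mx 0 i]).

Definition uniform (N : nat) (G : groupType) (g : 'I_N -> G) : Prop :=
  forall s : 'S_N, exists f : G -> G,
    [/\ {morph f : a b / (a * b)%g}, bijective f
      & forall i, f (g i) = g (s i)].

(* Unital complex C*-algebras.  The norm is a field of the mixin because
   [algType] and [completeNormedModType] have no join in the libraries. *)
HB.mixin Record isCstarAlgebra (R : realType) A of GRing.Algebra R[i] A := {
  star : A -> A;
  starK : involutive star;
  starD : {morph star : a b / a + b};
  starZ : forall (c : R[i]) (a : A), star (c *: a) = c^* *: star a;
  starM : forall a b : A, star (a * b) = star b * star a;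
  cnorm : A -> R;
  cnormD : forall a b : A, cnorm (a + b) <= cnorm a + cnorm b;
  cnormZ : forall (c : R[i]) (a : A),
    (cnorm (c *: a))%:C%C = `|c| * (cnorm a)%:C%C;
  cnorm0_eq0 : forall a : A, cnorm a = 0 -> a = 0;
  cnormM : forall a b : A, cnorm (a * b) <= cnorm a * cnorm b;
  cnorm_star : forall a : A, cnorm (star a * a) = cnorm a ^+ 2;
  cnorm_complete : forall u : nat -> A,
    (forall e : R, 0 < e -> exists n0, forall m n,
       (n0 <= m)%N -> (n0 <= n)%N -> cnorm (u m - u n) < e) ->
    exists l : A, (fun n => cnorm (u n - l)) @ \oo --> (0 : R)
}.

#[short(type="cstarType")]
HB.structure Definition CstarAlgebra (R : realType) :=
  { A of isCstarAlgebra R A & GRing.Algebra R[i] A }.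

Definition star_hom (R : realType) (A B : cstarType R) (f : A -> B) : Prop :=
  [/\ forall (c : R[i]) (a b : A), f (c *: a + b) = c *: f a + f b,
      {morph f : a b / a * b}, f 1 = 1 & {morph f : a / star a}].

(* (A, x) is the universal C*-algebra C*(x_t, t in T | rel). *)
Definition universal_cstar (R : realType) (T : Type)
    (rel : forall B : cstarType R, (T -> B) -> Prop)
    (A : cstarType R) (x : T -> A) : Prop :=
  rel A x /\
  forall (B : cstarType R) (y : T -> B), rel B y ->
    exists! f : A -> B, star_hom f /\ forall t, f (x t) = y t.

Definition sphere_rel (R : realType) (N : nat) (B : cstarType R)
    (x : 'I_N -> B) : Prop :=
  (forall i, x i = star (x i)) /\ \sum_(i < N) x i ^+ 2 = 1.

Definition is_free_sphere (R : realType) (N : nat) (A : cstarType R)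
    (x : 'I_N -> A) : Prop :=
  universal_cstar (@sphere_rel R N) x.

Definition unitary_rep (R : realType) (G : groupType) (B : cstarType R)
    (u : G -> B) : Prop :=
  [/\ u 1%g = 1, {morph u : a b / (a * b)%g >-> a * b}
    & forall a, star (u a) = u (a^-1)%g].

Definition is_group_cstar (R : realType) (G : groupType) (B : cstarType R)
    (u : G -> B) : Prop :=
  universal_cstar (@unitary_rep R G) u.

(* With A = C(S^{N-1}_{R,+}), a closed subset X is given by the quotient
   C(X) = A / J, hence by its kernel J, a closed two-sided ideal of A; equality
   of closed subsets is equality of these ideals. *)
Section ClosedSubsets.
Variables (R : realType) (A : cstarType R).

Definition norm_closed (J : set A) : Prop :=
  forall a, (forall e : R, 0 < e -> exists2 b, J b & cnorm (a - b) < e) -> J a.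

Definition closed_ideal (J : set A) : Prop :=
  [/\ norm_closed J, J 0, forall a b, J a -> J b -> J (a + b),
      forall a b, J b -> J (a * b) & forall a b, J b -> J (b * a)].

(* The closed subset cut out by the relations r = 0, for r in S. *)
Definition zero_locus (S : set A) : set A := smallest closed_ideal S.

Definition intersection (X Y : set A) : set A := zero_locus (X `|` Y).

Variables (N : nat) (x : 'I_N -> A).

Definition related (G : groupType) (g : 'I_N -> G) (k : nat)
    (i j : k.-tuple 'I_N) : Prop :=
  Pvert (kernel i j) /\
  (\prod_(a < k) g (tnth i a))%g = (\prod_(a < k) g (tnth j a))%g.

Definition sphere (G : groupType) (g : 'I_N -> G) : set A :=
  zero_locus [set r | exists (k : nat) (i j : k.-tuple 'I_N), related g i j /\
    r = \prod_(a < k) x (tnth i a) - \prod_(a < k) x (tnth j a)].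

Definition twisted_sphere (G : groupType) (g : 'I_N -> G) : set A :=
  zero_locus [set r | exists (k : nat) (i j : k.-tuple 'I_N), related g i j /\
    r = \prod_(a < k) x (tnth i a)
        - (\prod_(a < k) x (tnth j a)) *~ signature (kernel i j)].

(* C(X) = C*(G), with coordinates x_i = g_i / sqrt N. *)
Definition is_cube (G : groupType) (g : 'I_N -> G) (X : set A) : Prop :=
  exists (B : cstarType R) (u : G -> B) (f : A -> B),
    [/\ is_group_cstar u, star_hom f, set_surj setT setT f,
        forall i, f (x i) = (sqrtC N%:R)^-1 *: u (g i)
      & X = [set a | f a = 0]].

Definition cubes : set (set A) :=
  [set X | exists (G : groupType) (g : 'I_N -> G),
     [/\ reflection_group g, uniform g & is_cube g X]].

Definition spheres : set (set A) :=
  [set Y | exists (G : groupType) (g : 'I_N -> G),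
     [/\ reflection_group g, uniform g & Y = sphere g]].

Definition twisted_spheres : set (set A) :=
  [set Y | exists (G : groupType) (g : 'I_N -> G),
     [/\ reflection_group g, uniform g & Y = twisted_sphere g]].

End ClosedSubsets.

(* Main.v *)
From HB Require Import structures.
Require Import Defs.
From mathcomp Require Import all_boot all_order all_algebra all_fingroup.
From mathcomp Require Import complex.
From mathcomp Require Import all_classical all_reals all_analysis.
From mathcomp Require Import finmap ring lra zify.

(** Write [y_i = sqrt N x_i].  The relations [y_i^2 = 1] cut the free cube out of
    the free sphere, and a reflection group [G] is determined by the words [w]
    with [g_w = 1].  Because [G] maps onto [Z_2^N], every letter occurs an even
    number of times in such a word, so [w] can be compared with the word [w']
    having the same letters, equal ones grouped together: [g_w' = 1] holds in every
    reflection group, and [y_w' = 1] holds on the free cube.  The pair [(w, w')]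
    is one of those defining the sphere of [G], hence the sphere and the free
    cube together give back every relation of [G].  Their intersection is
    therefore the cube of [G] ([cube_of_sphere]), and the sphere determines the
    cube.

    Conversely the cube determines the sphere.  The relation [g_i = g_j] can be
    read off from the ideal of the cube, since [G] embeds in its C*-algebra
    ([cube_word_eq]).  This yields a formula for the sphere, and for the twisted
    sphere, in terms of the cube alone ([sphere_of], [twisted_sphere_of]).

    For the twisted spheres the free cube is replaced by a representation: the
    generators are made to act on functions on [G] as [g_a] times a sign, the
    signs being those of anticommuting Clifford generators.  A word in these
    operators is [g_w] times a sign that depends on the letters of [w], whatever
    their order, and on the parity of the number of inversions of [w].  On the other hand the
    signature of [ker (i, j)] is the parity of the number of inversions of [i]
    and [j] ([signature_kernel]): a switch changes this number by one, and
    a noncrossing word with even multiplicities has an even number of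
    inversions.  So the twisted relations hold for these operators exactly when
    the group relations hold ([twisted_representation]), and two groups with
    the same twisted sphere satisfy the same relations.

    Two constructions of C*-algebras are needed.  The quotient by a closed ideal
    ([cstar_ideal_quotient]) uses an approximate unit made of elements
    [(1 + t^2)^-1].  The faithful representations come from bounded operators on
    finitely supported functions ([cstar_of_signed_perms]); since that space is
    not complete, the algebra of operators is completed afterwards.  Both are
    obtained by separating a complete algebra with a C*-seminorm
    ([cstar_separated_quotient]).  Spectral theory is avoided throughout: if [c]
    and [d] are commuting self-adjoint elements with [c^2 + d^2 = 1] then
    [c + i d] is unitary, so [c] has norm at most 1 ([cnorm_le1]), and square
    roots and inverses are fixed points of contractions. *)

Import Order.TTheory GRing.Theory Num.Theory.
Import numFieldNormedType.Exports.

Set Implicit Arguments.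
Unset Strict Implicit.
Unset Printing Implicit Defensive.

Local Open Scope ring_scope.
Local Open Scope classical_set_scope.

Import Normc.

(** * C*-seminorms and their separated quotients *)

(** [p] may vanish on nonzero elements: this covers the distance to an ideal as
    well as the limit of the norms along a Cauchy sequence. *)
Record cstar_seminorm (R : realType) (P : algType R[i]) (st : P -> P)
    (p : P -> R) : Prop := CstarSeminorm {
  seminorm_starK : involutive st;
  seminorm_starD : {morph st : a b / a + b};
  seminorm_starZ : forall (c : R[i]) a, st (c *: a) = c^* *: st a;
  seminorm_starM : forall a b, st (a * b) = st b * st a;
  seminormD : forall a b, p (a + b) <= p a + p b;
  seminormZ : forall (c : R[i]) a, p (c *: a) = normc c * p a;
  seminormM : forall a b, p (a * b) <= p a * p b;
  seminorm_star_mul : forall a, p (st a * a) = p a ^+ 2 }.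

Definition seminorm_complete (R : realType) (P : algType R[i]) (p : P -> R) :=
  forall u : nat -> P,
    (forall e : R, 0 < e -> exists n0, forall m n,
       (n0 <= m)%N -> (n0 <= n)%N -> p (u m - u n) < e) ->
    exists l : P, forall e : R, 0 < e -> exists n0, forall n,
       (n0 <= n)%N -> p (u n - l) < e.

Section Seminorm.
Variables (R : realType) (P : algType R[i]) (st : P -> P) (p : P -> R).
Hypothesis hp : cstar_seminorm st p.

Lemma normc_normE (c : R[i]) : (normc c)%:C%C = `|c|.
Proof. by []. Qed.

Lemma normcN1 : normc (-1 : R[i]) = 1.
Proof. by rewrite /normc /= oppr0 sqrrN !expr2 mulr0 mulr1 addr0 sqrtr1. Qed.

Lemma seminorm0 : p 0 = 0.
Proof. by rewrite -(scale0r 0) (seminormZ hp) normc0 mul0r. Qed.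

Lemma seminormN a : p (- a) = p a.
Proof. by rewrite -scaleN1r (seminormZ hp) normcN1 mul1r. Qed.

Lemma seminorm_ge0 a : 0 <= p a.
Proof.
have := seminormD hp a (- a); rewrite subrr seminorm0 seminormN; lra.
Qed.

Lemma seminormB a b : p (a - b) <= p a + p b.
Proof. by rewrite -(seminormN b) (seminormD hp). Qed.

Lemma seminorm_distC a b : p (a - b) = p (b - a).
Proof. by rewrite -opprB seminormN. Qed.

Lemma seminorm_distD b a c : p (a - c) <= p (a - b) + p (b - c).
Proof. by have := seminormD hp (a - b) (b - c); rewrite subrKA. Qed.

(** The C*-identity gives [p a ^ 2 <= p (st a) * p a], hence one inequality; the
    other one is the same for [st a]. *)
Lemma seminorm_star a : p (st a) = p a.
Proof.
have le b : p b <= p (st b).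
  have [->|/eqP b0] := eqVneq (p b) 0; first exact: seminorm_ge0.
  have := seminormM hp (st b) b; rewrite (seminorm_star_mul hp) expr2.
  by rewrite ler_pM2r // lt_def seminorm_ge0 andbT; apply/eqP.
by apply/eqP; rewrite eq_le le andbT -{2}(seminorm_starK hp a) le.
Qed.

Lemma seminorm_star0 : st 0 = 0.
Proof. by apply: (addrI (st 0)); rewrite -(seminorm_starD hp) !addr0. Qed.

Lemma seminorm_starN a : st (- a) = - st a.
Proof.
by apply: (addrI (st a)); rewrite -(seminorm_starD hp) !subrr seminorm_star0.
Qed.

Lemma seminorm_starB a b : st (a - b) = st a - st b.
Proof. by rewrite (seminorm_starD hp) seminorm_starN. Qed.

Lemma seminorm_star1 : st 1 = 1.
Proof.
by rewrite -[LHS]mulr1 -{2}(seminorm_starK hp 1) -(seminorm_starM hp) mulr1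
  (seminorm_starK hp).
Qed.

Lemma seminorm_eq0_trans b a c : p (a - b) = 0 -> p (b - c) = 0 -> p (a - c) = 0.
Proof.
move=> ab bc; apply/eqP; rewrite eq_le seminorm_ge0 andbT.
by have := seminorm_distD b a c; rewrite ab bc addr0.
Qed.

Lemma seminorm_eq0M a a' b b' :
  p (a - a') = 0 -> p (b - b') = 0 -> p (a * b - a' * b') = 0.
Proof.
move=> ha hb; apply/eqP; rewrite eq_le seminorm_ge0 andbT.
have -> : a * b - a' * b' = (a - a') * b + a' * (b - b').
  by rewrite mulrBl mulrBr subrKA.
rewrite (le_trans (seminormD hp _ _)) //.
have := seminormM hp (a - a') b; have := seminormM hp a' (b - b').
rewrite ha hb; lra.
Qed.

Lemma seminorm_distE a b : p (a - b) = 0 -> p a = p b.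
Proof.
move=> ab; have h1 := seminormD hp (a - b) b; have h2 := seminormD hp (b - a) a.
move: h1 h2; rewrite !subrK (seminorm_distC b) ab; lra.
Qed.

End Seminorm.

Section SeparatedQuotient.
Variables (R : realType) (P : algType R[i]) (st : P -> P) (p : P -> R).
Hypotheses (hp : cstar_seminorm st p) (p1 : p 1 != 0)
  (pc : seminorm_complete p).

(** The chosen representative depends on the class only, by extensionality, so
    classes can be encoded as the elements that represent themselves. *)
Definition class_repr (a : P) : P := xget 0 [set b | p (b - a) = 0].

Lemma class_repr_dist a : p (class_repr a - a) = 0.
Proof.
apply: (@xgetPex _ 0 [set b | p (b - a) = 0]).
by exists a; rewrite /= subrr (seminorm0 hp).
Qed.

Lemma class_repr_eq a b : p (a - b) = 0 -> class_repr a = class_repr b.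
Proof.
move=> ab; rewrite /class_repr; congr (xget _ _); apply/funext => c /=.
apply/propext; split=> h; apply: (seminorm_eq0_trans hp h) => //.
by rewrite (seminorm_distC hp).
Qed.

Lemma class_reprK a : class_repr (class_repr a) = class_repr a.
Proof. exact/class_repr_eq/class_repr_dist. Qed.

(** The hypotheses are arguments of the type, so that the algebraic structures,
    which depend on them, can be attached to it. *)
Definition separated_quotient
  (_ : cstar_seminorm st p) (_ : p 1 != 0) (_ : seminorm_complete p) :=
  {a : P | class_repr a == a}.
Local Notation Q := (separated_quotient hp p1 pc).
HB.instance Definition _ := Choice.on Q.

Definition class_of (a : P) : Q :=
  exist _ (class_repr a) (introT eqP (class_reprK a)).

Lemma eq_class a b : p (a - b) = 0 -> class_of a = class_of b.
Proof. by move=> ab; apply: val_inj; apply: class_repr_eq. Qed.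

Lemma class_of_val (a : Q) : class_of (val a) = a.
Proof. by apply: val_inj; case: a => a h; apply/eqP. Qed.

Lemma val_class_of a : p (val (class_of a) - a) = 0.
Proof. exact: class_repr_dist. Qed.

Lemma class_of_surj (a : Q) : exists b, a = class_of b.
Proof. by exists (val a); rewrite class_of_val. Qed.

Let qadd (a b : Q) : Q := class_of (val a + val b).
Let qopp (a : Q) : Q := class_of (- val a).
Let qmul (a b : Q) : Q := class_of (val a * val b).
Let qscale (c : R[i]) (a : Q) : Q := class_of (c *: val a).
Let qstar (a : Q) : Q := class_of (st (val a)).
Let qnorm (a : Q) : R := p (val a).

Let qaddE a b : qadd (class_of a) (class_of b) = class_of (a + b).
Proof.
apply: eq_class; rewrite opprD addrACA; apply/eqP.
rewrite eq_le (seminorm_ge0 hp) andbT (le_trans (seminormD hp _ _)) //.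
by rewrite !val_class_of addr0.
Qed.

Let qoppE a : qopp (class_of a) = class_of (- a).
Proof. by apply: eq_class; rewrite -opprD (seminormN hp) val_class_of. Qed.

Let qmulE a b : qmul (class_of a) (class_of b) = class_of (a * b).
Proof. by apply: eq_class; apply: (seminorm_eq0M hp); rewrite val_class_of. Qed.

Let qscaleE c a : qscale c (class_of a) = class_of (c *: a).
Proof.
by apply: eq_class; rewrite -scalerBr (seminormZ hp) val_class_of mulr0.
Qed.

Let qstarE a : qstar (class_of a) = class_of (st a).
Proof.
by apply: eq_class; rewrite -(seminorm_starB hp) (seminorm_star hp) val_class_of.
Qed.

Let qnormE a : qnorm (class_of a) = p a.
Proof. exact/(seminorm_distE hp)/val_class_of. Qed.

Let qaddA : associative qadd.
Proof.
move=> a b c; have [[a' ->] [b' ->] [c' ->]] :=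
  And3 (class_of_surj a) (class_of_surj b) (class_of_surj c).
by rewrite !qaddE addrA.
Qed.
Let qaddC : commutative qadd.
Proof. by move=> a b; rewrite /qadd addrC. Qed.
Let qadd0 : left_id (class_of 0) qadd.
Proof. by move=> a; have [a' ->] := class_of_surj a; rewrite qaddE add0r. Qed.
Let qaddN : left_inverse (class_of 0) qopp qadd.
Proof.
by move=> a; have [a' ->] := class_of_surj a; rewrite qoppE qaddE addNr.
Qed.
HB.instance Definition _ := GRing.isZmodule.Build Q qaddA qaddC qadd0 qaddN.
Let classD a b : class_of a + class_of b = class_of (a + b).
Proof. exact: qaddE. Qed.
Let classN a : - class_of a = class_of (- a).
Proof. exact: qoppE. Qed.

Let qmulA : associative qmul.
Proof.
move=> a b c; have [[a' ->] [b' ->] [c' ->]] :=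
  And3 (class_of_surj a) (class_of_surj b) (class_of_surj c).
by rewrite !qmulE mulrA.
Qed.
Let qmul1 : left_id (class_of 1) qmul.
Proof. by move=> a; have [a' ->] := class_of_surj a; rewrite qmulE mul1r. Qed.
Let qmulr1 : right_id (class_of 1) qmul.
Proof. by move=> a; have [a' ->] := class_of_surj a; rewrite qmulE mulr1. Qed.
Let qmulDl : left_distributive qmul qadd.
Proof.
move=> a b c; have [[a' ->] [b' ->] [c' ->]] :=
  And3 (class_of_surj a) (class_of_surj b) (class_of_surj c).
by rewrite !(qaddE, qmulE) mulrDl.
Qed.
Let qmulDr : right_distributive qmul qadd.
Proof.
move=> a b c; have [[a' ->] [b' ->] [c' ->]] :=
  And3 (class_of_surj a) (class_of_surj b) (class_of_surj c).
by rewrite !(qaddE, qmulE) mulrDr.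
Qed.
Let q1_neq0 : class_of 1 != class_of 0.
Proof.
apply/eqP => /(congr1 qnorm); rewrite !qnormE (seminorm0 hp).
by move/eqP; rewrite (negPf p1).
Qed.
HB.instance Definition _ := GRing.Zmodule_isNzRing.Build Q
  qmulA qmul1 qmulr1 qmulDl qmulDr q1_neq0.
Let classM a b : class_of a * class_of b = class_of (a * b).
Proof. exact: qmulE. Qed.

Let qscaleA c d a : qscale c (qscale d a) = qscale (c * d) a.
Proof. by have [a' ->] := class_of_surj a; rewrite !qscaleE scalerA. Qed.
Let qscale1 : left_id 1 qscale.
Proof. by move=> a; have [a' ->] := class_of_surj a; rewrite qscaleE scale1r. Qed.
Let qscaleDr : right_distributive qscale +%R.
Proof.
move=> c a b; have [[a' ->] [b' ->]] := conj (class_of_surj a) (class_of_surj b).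
by rewrite !(qscaleE, classD) scalerDr.
Qed.
Let qscaleDl a : {morph qscale^~ a : c d / c + d}.
Proof.
by move=> c d; have [a' ->] := class_of_surj a; rewrite !(qscaleE, classD) scalerDl.
Qed.
HB.instance Definition _ := GRing.Zmodule_isLmodule.Build R[i] Q
  qscaleA qscale1 qscaleDr qscaleDl.
Let classZ c a : c *: class_of a = class_of (c *: a).
Proof. exact: qscaleE. Qed.
Let qscaleAl c (a b : Q) : c *: (a * b) = c *: a * b.
Proof.
have [[a' ->] [b' ->]] := conj (class_of_surj a) (class_of_surj b).
by rewrite !(classZ, classM) scalerAl.
Qed.
HB.instance Definition _ := GRing.Lmodule_isLalgebra.Build R[i] Q qscaleAl.
Let qscaleAr c (a b : Q) : c *: (a * b) = a * (c *: b).
Proof.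
have [[a' ->] [b' ->]] := conj (class_of_surj a) (class_of_surj b).
by rewrite !(classZ, classM) scalerAr.
Qed.
HB.instance Definition _ := GRing.Lalgebra_isAlgebra.Build R[i] Q qscaleAr.

Let qstarK : involutive qstar.
Proof.
by move=> a; have [a' ->] := class_of_surj a; rewrite !qstarE (seminorm_starK hp).
Qed.
Let qstarD : {morph qstar : a b / a + b}.
Proof.
move=> a b; have [[a' ->] [b' ->]] := conj (class_of_surj a) (class_of_surj b).
by rewrite !(qstarE, classD) (seminorm_starD hp).
Qed.
Let qstarZ c a : qstar (c *: a) = c^* *: qstar a.
Proof.
by have [a' ->] := class_of_surj a; rewrite !(qstarE, classZ) (seminorm_starZ hp).
Qed.
Let qstarM a b : qstar (a * b) = qstar b * qstar a.
Proof.
have [[a' ->] [b' ->]] := conj (class_of_surj a) (class_of_surj b).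
by rewrite !(qstarE, classM) (seminorm_starM hp).
Qed.
Let qnormD a b : qnorm (a + b) <= qnorm a + qnorm b.
Proof.
have [[a' ->] [b' ->]] := conj (class_of_surj a) (class_of_surj b).
by rewrite !(classD, qnormE) (seminormD hp).
Qed.
Let qnormZ c a : (qnorm (c *: a))%:C%C = `|c| * (qnorm a)%:C%C.
Proof.
have [a' ->] := class_of_surj a.
by rewrite !(classZ, qnormE) (seminormZ hp) rmorphM /= normc_normE.
Qed.
Let qnorm0_eq0 a : qnorm a = 0 -> a = 0.
Proof.
have [a' ->] := class_of_surj a; rewrite qnormE => a0.
by apply: eq_class; rewrite subr0.
Qed.
Let qnormM a b : qnorm (a * b) <= qnorm a * qnorm b.
Proof.
have [[a' ->] [b' ->]] := conj (class_of_surj a) (class_of_surj b).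
by rewrite !(classM, qnormE) (seminormM hp).
Qed.
Let qnorm_star a : qnorm (qstar a * a) = qnorm a ^+ 2.
Proof.
have [a' ->] := class_of_surj a.
by rewrite qstarE classM !qnormE (seminorm_star_mul hp).
Qed.
Let qnorm_dist (a b : Q) : qnorm (a - b) = p (val a - val b).
Proof.
by rewrite -{1}(class_of_val a) -{1}(class_of_val b) classN classD qnormE.
Qed.
Let qcomplete (u : nat -> Q) :
  (forall e : R, 0 < e -> exists n0, forall m n,
     (n0 <= m)%N -> (n0 <= n)%N -> qnorm (u m - u n) < e) ->
  exists l : Q, (fun n => qnorm (u n - l)) @ \oo --> (0 : R).
Proof.
move=> hu.
have [e /hu[n0 hn0]|l hl] := pc (u := fun n => val (u n)).
  by exists n0 => m n hm hn; rewrite -qnorm_dist hn0.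
exists (class_of l); apply/cvgrPdist_lt => e /hl[n0 hn0].
exists n0 => // n /= hn; rewrite sub0r normrN ger0_norm ?(seminorm_ge0 hp) //.
by rewrite -{1}(class_of_val (u n)) classN classD qnormE hn0.
Qed.
HB.instance Definition _ := isCstarAlgebra.Build R Q
  qstarK qstarD qstarZ qstarM qnormD qnormZ qnorm0_eq0 qnormM qnorm_star qcomplete.

(** Completeness is assumed of the seminorm and not of the quotient because
    a Cauchy sequence of classes lifts to a Cauchy sequence of
    representatives. *)
Lemma cstar_separated_quotient : exists (B : cstarType R) (f : P -> B),
  [/\ forall (c : R[i]) a b, f (c *: a + b) = c *: f a + f b,
      {morph f : a b / a * b}, f 1 = 1
    & [/\ forall a, f (st a) = star (f a), forall b, exists a, b = f a
        & forall a, cnorm (f a) = p a]].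
Proof.
exists Q, class_of; split=> [c a b|a b||].
- by rewrite -classD -classZ.
- by rewrite -classM.
- by [].
- by split=> [a||a]; [rewrite -qstarE | exact: class_of_surj | exact: qnormE].
Qed.

End SeparatedQuotient.

(** * Norms, square roots and inverses in a C*-algebra *)

Section CstarNorm.
Variables (R : realType) (A : cstarType R).
Implicit Types (a b c h t y : A).

Lemma normc_real (r : R) : normc r%:C%C = `|r|.
Proof. by rewrite /normc /= (expr2 0) mul0r addr0 sqrtr_sqr. Qed.

Lemma cnorm_seminorm : cstar_seminorm (@star R A) (@cnorm R A).
Proof.
split; [exact: starK|exact: starD|exact: starZ|exact: starM|exact: cnormD| |
  exact: cnormM|exact: cnorm_star].
by move=> c a; apply: (@complexI R); rewrite cnormZ rmorphM.
Qed.
Let hA := cnorm_seminorm.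

Lemma cnorm_seminorm_complete : seminorm_complete (@cnorm R A).
Proof.
move=> u /cnorm_complete[l /cvgrPdist_lt hl]; exists l => e /hl[n0 _ hn0].
exists n0 => n /hn0 /=.
by rewrite sub0r normrN ger0_norm // (seminorm_ge0 hA).
Qed.

Lemma cnormZr (r : R) a : cnorm (r%:C%C *: a) = `|r| * cnorm a.
Proof. by rewrite (seminormZ hA) normc_real. Qed.

Lemma starZr (r : R) a : star (r%:C%C *: a) = r%:C%C *: star a.
Proof. by rewrite starZ -[X in X *: _]/(conjc _) conjc_real. Qed.

Lemma cnorm1 : cnorm (1 : A) = 1.
Proof.
have := cnorm_star (1 : A); rewrite (seminorm_star1 hA) mulr1 expr2.
rewrite -{1}[cnorm 1]mulr1 => /(mulfI _)-> //.
by apply: contra_neq (oner_neq0 A); apply: cnorm0_eq0.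
Qed.

Lemma norm_closed_le (q : R) : norm_closed [set a : A | cnorm a <= q].
Proof.
move=> a ha /=; apply/ler_addgt0Pr => e /ha[b /= hb hab].
have := seminorm_distD hA b a 0; rewrite !subr0; lra.
Qed.

Lemma norm_closed_setI (K L : set A) :
  norm_closed K -> norm_closed L -> norm_closed (K `&` L).
Proof.
by move=> hK hL a ha; split; [apply: hK|apply: hL] => e /ha[b [? ?] ?]; exists b.
Qed.

Lemma norm_closed_bigI (I : Type) (D : set I) (K : I -> set A) :
  (forall i, D i -> norm_closed (K i)) ->
  norm_closed [set a : A | forall i, D i -> K i a].
Proof.
by move=> hK a ha i Di; apply: (hK i Di) => e /ha[b hb ?]; exists b => //; apply: hb.
Qed.

Lemma expr_lt_eps (q d e : R) : 0 <= q < 1 -> 0 <= d -> 0 < e ->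
  exists n0, forall n, (n0 <= n)%N -> q ^+ n * d < e.
Proof.
move=> /andP[q0 q1] d0 e0; have d1 : 0 < d + 1 by lra.
have /cvgrPdist_lt/(_ (e / (d + 1))) : (GRing.exp q : nat -> R) @ \oo --> (0 : R).
  by apply: cvg_expr; rewrite ger0_norm.
rewrite divr_gt0 // => /(_ isT)[n0 _ hn0]; exists n0 => n /hn0 /=.
have qn : 0 <= q ^+ n by exact: exprn_ge0.
by rewrite sub0r normrN ger0_norm // ltr_pdivlMr //; nra.
Qed.

Lemma cnorm_geometric_cvg (u : nat -> A) (q d : R) : 0 <= q < 1 ->
  (forall n, cnorm (u n.+1 - u n) <= q ^+ n * d) ->
  exists l : A, forall e : R, 0 < e -> exists n0, forall n,
    (n0 <= n)%N -> cnorm (u n - l) < e.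
Proof.
move=> q01 step; have /andP[q0 q1] := q01.
have d0 : 0 <= d.
  by have := le_trans (seminorm_ge0 hA _) (step 0%N); rewrite expr0 mul1r.
have q1' : 0 < 1 - q by rewrite subr_gt0.
have far n m : cnorm (u (n + m)%N - u n) * (1 - q) <= q ^+ n * d * (1 - q ^+ m).
  elim: m => [|m IH].
    by rewrite addn0 subrr (seminorm0 hA) mul0r expr0 subrr mulr0.
  have h1 := seminorm_distD hA (u (n + m)%N) (u (n + m.+1)%N) (u n).
  have h2 := step (n + m)%N; rewrite -addnS exprD in h2.
  have {h1 h2} h : cnorm (u (n + m.+1)%N - u n) <=
      q ^+ n * q ^+ m * d + cnorm (u (n + m)%N - u n) by lra.
  rewrite -(ler_pM2r q1') in h; apply: le_trans h _; rewrite mulrDl exprS.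
  by lra.
have qm m : 0 <= q ^+ m <= 1 by rewrite exprn_ge0 ?exprn_ile1 // ltW.
apply: cnorm_seminorm_complete => e e0.
have [n0 hn0] := @expr_lt_eps q d (e * (1 - q) / 2) q01 d0
  ltac:(by rewrite !(mulr_gt0, divr_gt0)).
exists n0 => m n hm hn.
have near k : (n0 <= k)%N -> cnorm (u k - u n0) < e / 2.
  move=> hk; have := far n0 (k - n0)%N; rewrite subnKC // => h.
  rewrite -(ltr_pM2r q1'); apply: le_lt_trans h _.
  have := hn0 _ (leqnn n0); have := qm (k - n0)%N => /andP[? ?].
  have ? : 0 <= q ^+ n0 * d by rewrite mulr_ge0 ?exprn_ge0.
  nra.
have := seminorm_distD hA (u n0) (u m) (u n).
have := near _ hm; have := near _ hn; rewrite (seminorm_distC hA (u n)); lra.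
Qed.

(** This replaces power series: the set [K] keeps track of the properties
    (self-adjointness, commutation, a bound) that the fixed point inherits from
    the approximations. *)
Lemma contraction_fixpoint (F : A -> A) (K : set A) (q : R) a0 :
  norm_closed K -> K a0 -> (forall a, K a -> K (F a)) -> 0 <= q < 1 ->
  (forall a b, K a -> K b -> cnorm (F a - F b) <= q * cnorm (a - b)) ->
  exists2 l, K l & F l = l.
Proof.
move=> Kc Ka0 KF q01 Fq; have /andP[q0 q1] := q01.
pose u n := iter n F a0.
have Ku n : K (u n) by elim: n => //= n IH; exact: KF.
have [n|l hl] := @cnorm_geometric_cvg u q (cnorm (u 1%N - u 0%N)) q01.
  elim: n => [|n IH]; first by rewrite expr0 mul1r.
  rewrite (le_trans (Fq _ _ (Ku n.+1) (Ku n))) // exprS -mulrA.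
  by rewrite ler_wpM2l.
have Kl : K l.
  apply: Kc => e /hl[n0 /(_ n0 (leqnn _))] h; exists (u n0) => //.
  by rewrite (seminorm_distC hA).
exists l => //; apply/eqP; rewrite -subr_eq0; apply/eqP/cnorm0_eq0/eqP.
rewrite eq_le (seminorm_ge0 hA) andbT; apply/ler_addgt0Pr => e e0; rewrite add0r.
have [n0 hn0] := hl (e / 2) ltac:(by rewrite divr_gt0).
have := seminorm_distD hA (u n0.+1) (F l) l.
have := Fq _ _ Kl (Ku n0); rewrite -[F (u n0)]/(u n0.+1).
have := hn0 _ (leqnn _); have := hn0 _ (leqnSn _).
rewrite (seminorm_distC hA l).
have := seminorm_ge0 hA (u n0 - l); nra.
Qed.

End CstarNorm.

Section CstarCalculus.
Variables (R : realType) (A : cstarType R).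
Implicit Types (a b c h t y : A).
Let hA := @cnorm_seminorm R A.

Lemma norm_closed_ker (B : cstarType R) (phi : A -> B) (C : R) :
  (forall a b, phi (a - b) = phi a - phi b) -> 0 <= C ->
  (forall a, cnorm (phi a) <= C * cnorm a) ->
  norm_closed [set a : A | phi a = 0].
Proof.
move=> phiB C0 phiC a ha /=; apply: cnorm0_eq0; apply/eqP.
rewrite eq_le (seminorm_ge0 (@cnorm_seminorm R B)) andbT.
apply/ler_addgt0Pr => e e0; rewrite add0r.
have C1 : 0 < C + 1 by lra.
have [|b /= hb hab] := ha (e / (C + 1)); first by rewrite divr_gt0.
have := phiC (a - b); rewrite phiB hb subr0 => /le_trans-> //.
have := seminorm_ge0 hA (a - b); rewrite ltr_pdivlMr // in hab; nra.
Qed.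

Lemma norm_closed_selfadjoint : norm_closed [set a : A | star a = a].
Proof.
have -> : [set a : A | star a = a] = [set a : A | star a - a = 0].
  by apply/seteqP; split=> a /= /eqP h; apply/eqP; rewrite ?subr_eq0 // -subr_eq0.
apply: (@norm_closed_ker A _ 2) => [a b||a] //.
  by rewrite (seminorm_starB hA) !opprD addrACA.
by have := seminormB hA (star a) a; rewrite (seminorm_star hA); lra.
Qed.

Lemma norm_closed_commutant c : norm_closed [set a | c * a = a * c].
Proof.
have -> : [set a | c * a = a * c] = [set a | c * a - a * c = 0].
  by apply/seteqP; split=> a /= /eqP h; apply/eqP; rewrite ?subr_eq0 // -subr_eq0.
apply: (@norm_closed_ker A _ (2 * cnorm c)) => [a b||a].
- by rewrite mulrBr mulrBl !opprD addrACA.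
- by rewrite mulr_ge0 ?(seminorm_ge0 hA).
- have := seminormB hA (c * a) (a * c).
  by have := cnormM c a; have := cnormM a c; lra.
Qed.

(** The equation [(1 - y)^2 = 1 - h] reads [y = (h + y^2) / 2], whose right-hand
    side is a contraction of the ball of radius [cnorm h]. *)
Lemma sqrt_one_sub h : star h = h -> cnorm h < 1 ->
  exists y, [/\ star y = y, forall c, c * h = h * c -> c * y = y * c
              & (1 - y) * (1 - y) = 1 - h].
Proof.
move=> sh h1; pose F y := (2^-1)%:C%C *: (h + y * y).
pose K := [set y | cnorm y <= cnorm h] `&` [set y | star y = y] `&`
  [set y | forall c, [set c | c * h = h * c] c -> [set y | c * y = y * c] y].
have half : `|2^-1| = 2^-1 :> R by rewrite ger0_norm.
have K0 : norm_closed K.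
  apply: norm_closed_setI; last first.
    by apply: norm_closed_bigI => c _; exact: norm_closed_commutant.
  by apply: norm_closed_setI; [exact: norm_closed_le|exact: norm_closed_selfadjoint].
have h0 := seminorm_ge0 hA h.
have [||||y [[ny sy] cy] Fy] := @contraction_fixpoint R A F K (cnorm h) 0 K0.
- split; first split => /=; first by rewrite (seminorm0 hA).
    exact: (seminorm_star0 hA).
  by move=> c _ /=; rewrite mulr0 mul0r.
- move=> y [[/= ny sy] cy]; split; first split => /=.
  + rewrite cnormZr half; have := cnormD h (y * y); have := cnormM y y.
    have := seminorm_ge0 hA y; nra.
  + by rewrite starZr starD starM sy sh.
  + move=> c ch /=; rewrite -scalerAl -scalerAr mulrDl mulrDr ch.
    by rewrite mulrA (cy c) // -!mulrA (cy c).
- by rewrite h0.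
- move=> a b [[/= na _] _] [[/= nb _] _].
  have -> : F a - F b = (2^-1)%:C%C *: (a * (a - b) + (a - b) * b).
    rewrite -scalerBr opprD addrACA subrr add0r mulrBr mulrBl addrA.
    by rewrite subrK.
  rewrite cnormZr half; have := cnormD (a * (a - b)) ((a - b) * b).
  have := cnormM a (a - b); have := cnormM (a - b) b.
  have := seminorm_ge0 hA (a - b); nra.
exists y; split=> //.
have e : h + y * y = y + y.
  rewrite -{3 4}Fy -scalerDl -rmorphD /= (_ : 2^-1 + 2^-1 = 1 :> R).
    by rewrite scale1r.
  by lra.
have -> : h = y + y - y * y by rewrite -e addrK.
by rewrite mulrBr mulr1 mulrBl mul1r !opprB opprD !addrA [1 - y + _]addrAC.
Qed.

(** The element [c + i d] is unitary, hence of norm 1, and [c] is its real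
    part.  This is the source of all norm estimates below. *)
Lemma cnorm_le1 c d : star c = c -> star d = d -> c * d = d * c ->
  c * c + d * d = 1 -> cnorm c <= 1.
Proof.
move=> sc sd cd cd1; pose u := c + 'i *: d.
have su : star u = c - 'i *: d by rewrite starD starZ sc sd conjCi scaleNr.
have uu : star u * u = 1.
  rewrite su mulrDr !mulrBl -!scalerAl -!scalerAr cd scalerA -(expr2 'i) sqrCi.
  by rewrite scaleN1r opprK addrA subrK.
have nu : cnorm u = 1.
  have := cnorm_star u; rewrite uu cnorm1 => /esym/eqP; rewrite sqrf_eq1.
  have u0 := seminorm_ge0 hA u; case/orP=> /eqP // u1.
  by move: u0; rewrite u1; lra.
have nc : (2 : R)%:C%C *: c = u + star u.
  by rewrite su addrACA subrr addr0 rmorph_nat scaler_nat.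
have := cnormD u (star u); rewrite -nc cnormZr (seminorm_star hA) nu.
by rewrite ger0_norm //; lra.
Qed.

(** Rescale [t = m s] with [s] of norm less than 1.  Then [w = 1 - s^2] is the
    square of a self-adjoint element commuting with [s], so it has norm at most
    1, and [1 + t^2 = (1 + m^2) (1 - q w)] with [q = m^2 / (1 + m^2) < 1] is
    inverted by a Neumann series. *)
Lemma inv_one_add_sq t : star t = t ->
  exists r, [/\ star r = r, t * r = r * t & r * (1 + t * t) = 1].
Proof.
move=> st; have t0 := seminorm_ge0 hA t.
pose m := 1 + cnorm t; pose s := (m^-1)%:C%C *: t.
have m0 : 0 < m by rewrite /m; lra.
have ss : star s = s by rewrite starZr st.
have ns : cnorm s < 1.
  rewrite cnormZr ger0_norm ?invr_ge0 ?(ltW m0) // mulrC ltr_pdivrMr //.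
  by rewrite /m; lra.
have ts : t = m%:C%C *: s.
  by rewrite scalerA -rmorphM /= divff ?gt_eqF // scale1r.
clearbody s; have n0 := seminorm_ge0 hA s.
have [||y [sy cy ey]] := @sqrt_one_sub (s * s); first by rewrite starM ss.
  by have := cnormM s s; nra.
have sb : star (1 - y) = 1 - y.
  by rewrite (seminorm_starB hA) (seminorm_star1 hA) sy.
pose w := 1 - s * s.
have nw : cnorm w <= 1.
  rewrite /w -ey; have n1 : cnorm (1 - y) <= 1.
    apply: (@cnorm_le1 _ s) => //; last by rewrite ey subrK.
    by rewrite mulrBr mulrBl mulr1 mul1r cy // mulrA.
  by have := cnormM (1 - y) (1 - y); have := seminorm_ge0 hA (1 - y); nra.
have sw : star w = w.
  by rewrite (seminorm_starB hA) (seminorm_star1 hA) starM ss.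
have ws : s * w = w * s by rewrite mulrBr mulrBl mulr1 mul1r mulrA.
have ew : s * s = 1 - w by rewrite opprB addrC subrK.
clearbody w.
have m2 : 0 < 1 + m ^+ 2 by rewrite ltr_wpDr ?sqr_ge0.
pose q := m ^+ 2 / (1 + m ^+ 2).
have q0 : 0 <= q by rewrite divr_ge0 ?sqr_ge0 ?ltW.
have q1 : q < 1 by rewrite ltr_pdivrMr // mul1r; lra.
pose F z := 1 + q%:C%C *: (w * z).
pose K := [set z | star z = z] `&` [set z | s * z = z * s] `&`
  [set z | w * z = z * w].
have K0 : norm_closed K.
  apply: norm_closed_setI; last exact: norm_closed_commutant.
  by apply: norm_closed_setI; [exact: norm_closed_selfadjoint
                              |exact: norm_closed_commutant].
have [||||z [[/= sz szs] wz] Fz] := @contraction_fixpoint R A F K q 0 K0.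
- by split; first split; rewrite /= ?(seminorm_star0 hA) ?mulr0 ?mul0r.
- move=> z [[/= sz szs] wz]; split; first split => /=.
  + by rewrite starD (seminorm_star1 hA) starZr starM sz sw -wz.
  + rewrite /F mulrDr mulrDl mulr1 mul1r -scalerAl -scalerAr.
    by rewrite mulrA ws -!mulrA szs.
  + rewrite /= /F mulrDr mulrDl mulr1 mul1r -scalerAl -scalerAr.
    by rewrite -!mulrA wz.
- by rewrite q0.
- move=> a b _ _; have -> : F a - F b = q%:C%C *: (w * (a - b)).
    by rewrite /F mulrBr scalerBr opprD addrACA subrr add0r.
  rewrite cnormZr ger0_norm // ler_wpM2l // (le_trans (cnormM _ _)) //.
  by rewrite -[leRHS]mul1r ler_wpM2r // (seminorm_ge0 hA).
exists ((1 + m ^+ 2)^-1%:C%C *: z); split.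
- by rewrite starZr sz.
- by rewrite ts -!scalerAl -!scalerAr szs !scalerA mulrC.
have -> : 1 + t * t = (1 + m ^+ 2)%:C%C *: (1 - q%:C%C *: w).
  rewrite ts -scalerAl -scalerAr scalerA scalerBr scalerA -!rmorphM /=.
  rewrite mulrCA divff ?gt_eqF // mulr1 -expr2 ew scalerBr addrA.
  by rewrite rmorphD scalerDl /= scale1r.
rewrite -scalerAl -scalerAr scalerA -rmorphM /= mulVf ?gt_eqF // scale1r.
by rewrite mulrBr mulr1 -scalerAr -wz -{1}Fz addrK.
Qed.

End CstarCalculus.

(** With [b^2 = 1 - h^2], the images [f h] and [f b] are commuting self-adjoint
    elements whose squares add up to 1. *)
Lemma star_hom_contractive_selfadjoint (R : realType) (A B : cstarType R) (f : A -> B) h :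
  star_hom f -> star h = h -> cnorm h < 1 -> cnorm (f h) <= 1.
Proof.
case=> fL fM f1 fS sh h1; have hA := @cnorm_seminorm R A; have h0 := seminorm_ge0 hA h.
have [||y [sy cy ey]] := @sqrt_one_sub R A (h * h); first by rewrite starM sh.
  by have := cnormM h h; nra.
have f0 : f 0 = 0 by have := fL (-1) 0 0; rewrite scaler0 addr0 scaleN1r addNr.
have fD a b : f (a + b) = f a + f b by have := fL 1 a b; rewrite !scale1r.
apply: (@cnorm_le1 R B _ (f (1 - y))); rewrite -?fS -?fM -?fD ?sh //.
- by rewrite (seminorm_starB hA) (seminorm_star1 hA) sy.
- by congr f; rewrite mulrBr mulrBl mulr1 mul1r cy // mulrA.
- by rewrite ey addrC subrK.
Qed.

Section StarHom.
Variables (R : realType) (A B : cstarType R) (f : A -> B).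
Hypothesis hf : star_hom f.
Let hA := @cnorm_seminorm R A.
Let hB := @cnorm_seminorm R B.

Lemma star_homD a b : f (a + b) = f a + f b.
Proof. by case: hf => fL _ _ _; have := fL 1 a b; rewrite !scale1r. Qed.

Lemma star_hom0 : f 0 = 0.
Proof. by apply: (addrI (f 0)); rewrite -star_homD !addr0. Qed.

Lemma star_homZ c a : f (c *: a) = c *: f a.
Proof. by case: hf => fL _ _ _; have := fL c a 0; rewrite star_hom0 !addr0. Qed.

Lemma star_homB a b : f (a - b) = f a - f b.
Proof. by rewrite -[- b]scaleN1r star_homD star_homZ scaleN1r. Qed.

Lemma star_homM a b : f (a * b) = f a * f b.
Proof. by case: hf. Qed.

Lemma star_hom1 : f 1 = 1.
Proof. by case: hf. Qed.

Lemma star_hom_star a : f (star a) = star (f a).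
Proof. by case: hf. Qed.

(** Continuity of morphisms is what makes their kernels closed ideals, so that
    a morphism killing some relations kills the closed ideal they generate. *)
Lemma star_hom_contractive a : cnorm (f a) <= cnorm a.
Proof.
have sa h : star h = h -> cnorm (f h) <= cnorm h.
  move=> sh; apply/ler_addgt0Pr => e e0; have h0 := seminorm_ge0 hA h.
  have k0 : 0 < cnorm h + e by lra.
  have ik : `|(cnorm h + e)^-1| = (cnorm h + e)^-1.
    by rewrite ger0_norm // invr_ge0 ltW.
  have := @star_hom_contractive_selfadjoint R A B f
    ((cnorm h + e)^-1%:C%C *: h) hf.
  rewrite star_homZ !cnormZr ik starZr sh => /(_ erefl).
  rewrite mulrC ltr_pdivrMr // mul1r mulrC ler_pdivrMr // mul1r; apply; lra.
have := sa (star a * a); rewrite starM starK => /(_ erefl).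
rewrite star_homM star_hom_star !cnorm_star.
have := seminorm_ge0 hA a; have := seminorm_ge0 hB (f a); nra.
Qed.

Lemma star_hom_ker_closed_ideal : closed_ideal [set a | f a = 0].
Proof.
split=> [||a b /= fa fb|a b /= fb|a b /= fb].
- apply: (@norm_closed_ker _ _ _ f 1) => // [a b|a]; first exact: star_homB.
  by rewrite mul1r star_hom_contractive.
- exact: star_hom0.
- by rewrite star_homD fa fb addr0.
- by rewrite star_homM fb mulr0.
- by rewrite star_homM fb mul0r.
Qed.

Lemma star_hom_zero_locus (S : set A) : (forall a, S a -> f a = 0) ->
  forall a, zero_locus S a -> f a = 0.
Proof.
move=> Sf a Sa; apply: (Sa [set a | f a = 0]).
by split=> //; exact: star_hom_ker_closed_ideal.
Qed.

End StarHom.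

(** * Quotients of C*-algebras by closed ideals *)

Lemma zero_locus_closed_ideal (R : realType) (A : cstarType R) (S : set A) :
  closed_ideal (zero_locus S).
Proof.
split=> [a ha K hK|K [[]]|a b ha hb K hK|a b hb K hK|a b hb K hK] //.
- have [[Kc _ _ _ _] _] := hK; apply: Kc => e /ha[b hb ab].
  by exists b => //; exact: hb K hK.
- by have [[_ _ KD _ _] _] := hK; apply: KD; [exact: ha K hK|exact: hb K hK].
- by have [[_ _ _ Kl _] _] := hK; apply: Kl; exact: hb K hK.
- by have [[_ _ _ _ Kr] _] := hK; apply: Kr; exact: hb K hK.
Qed.

Lemma zero_locus_sub (R : realType) (A : cstarType R) (S : set A) :
  S `<=` zero_locus S.
Proof. by move=> a Sa K [_ SK]; exact: SK. Qed.

Section IdealQuotient.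
Variables (R : realType) (A : cstarType R) (J : set A).
Hypothesis hJ : closed_ideal J.
Implicit Types (a b j k r t : A).
Let hA := @cnorm_seminorm R A.

Lemma ideal0 : J 0. Proof. by case: hJ. Qed.
Lemma idealD a b : J a -> J b -> J (a + b). Proof. by case: hJ => _ _ h _ _; exact: h. Qed.
Lemma idealMl a b : J b -> J (a * b). Proof. by case: hJ => _ _ _ h _; exact: h. Qed.
Lemma idealMr a b : J b -> J (b * a). Proof. by case: hJ => _ _ _ _ h; exact: h. Qed.
Lemma idealZ (c : R[i]) a : J a -> J (c *: a).
Proof. by rewrite -[a in _ *: a]mul1r scalerAl; exact: idealMl. Qed.
Lemma idealN a : J a -> J (- a).
Proof. by rewrite -scaleN1r; exact: idealZ. Qed.
Lemma idealB a b : J a -> J b -> J (a - b).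
Proof. by move=> Ja Jb; apply/idealD => //; apply: idealN. Qed.

(** Take [r = (1 + s^2)^-1] with [s = t / e].  Then [1 - r = r s^2] lies in [J],
    and [(2 r - 1)^2 + (2 s r)^2 = 1], so that [2 r - 1] and [2 s r] have norm at
    most 1. *)
Lemma ideal_approx_unit t (e : R) : J t -> star t = t -> 0 < e ->
  exists r, [/\ star r = r, cnorm r <= 1, J (1 - r) & cnorm (t * r) <= e].
Proof.
move=> Jt st e0; pose s := (e^-1)%:C%C *: t.
have ss : star s = s by rewrite starZr st.
have Js : J s by exact: idealZ.
have ts : t = e%:C%C *: s by rewrite scalerA -rmorphM /= divff ?gt_eqF // scale1r.
clearbody s; have [r [sr sr' r1]] := inv_one_add_sq ss.
pose a := r + r; have sa : star a = a by rewrite starD sr.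
have sas : s * a = a * s by rewrite mulrDr mulrDl sr'.
have a2 : a * (1 + s * s) = 2 by rewrite mulrDl r1.
have ra : r = (2^-1)%:C%C *: a.
  rewrite /a scalerDr -scalerDl -rmorphD /= (_ : 2^-1 + 2^-1 = 1 :> R) ?scale1r //.
  by lra.
clearbody a.
have aa : a * a + (s * a) * (s * a) = a *+ 2.
  have : a * (1 + s * s) * a = a *+ 2 by rewrite a2 mulr_natl.
  by rewrite mulrDr mulr1 mulrDl => <-; rewrite {1}sas !mulrA.
have sc : star (a - 1) = a - 1 by rewrite (seminorm_starB hA) sa (seminorm_star1 hA).
have sd : star (s * a) = s * a by rewrite starM sa ss.
have cd : (a - 1) * (s * a) = s * a * (a - 1).
  by rewrite mulrBl mulrBr mul1r mulr1 mulrA -sas.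
have cd1 : (a - 1) * (a - 1) + s * a * (s * a) = 1.
  have -> : (a - 1) * (a - 1) = a * a - a *+ 2 + 1 by rewrite -expr2 sqrrB1.
  by rewrite -aa opprD addrA subrr add0r addrAC addNr add0r.
have n1 := cnorm_le1 sc sd cd cd1; have n2 : cnorm (s * a) <= 1.
  by apply: (@cnorm_le1 _ _ _ (a - 1)) => //; rewrite addrC.
have h2 : `|2^-1| = 2^-1 :> R by rewrite ger0_norm.
exists r; split=> //.
- rewrite ra cnormZr h2; have := cnormD (a - 1) 1; rewrite subrK cnorm1; lra.
- by rewrite -r1 mulrDr mulr1 addrAC subrr add0r; do 2!apply: idealMl.
- rewrite ts ra -scalerAl -scalerAr !cnormZr h2 ger0_norm ?(ltW e0) //.
  by have := seminorm_ge0 hA (s * a); nra.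
Qed.

(** For an approximate unit [1 - r] relative to [star a * a], the element
    [a * r] is small because [(a r)^* (a r) = r (a^* a) r], and
    [star a - star (a r) = (1 - r) star a] lies in [J]. *)
Lemma ideal_star a : J a -> J (star a).
Proof.
move=> Ja; have [Jc _ _ _ _] := hJ; apply: Jc => e e0.
pose t := star a * a; have st : star t = t by rewrite starM starK.
have [r [sr r1 Jr tr]] := @ideal_approx_unit t (e ^+ 2 / 4) (idealMl _ Ja) st
  ltac:(by rewrite divr_gt0 ?exprn_gt0).
exists ((1 - r) * star a); first exact: idealMr.
rewrite mulrBl mul1r opprB addrC subrK.
have -> : r * star a = star (a * r) by rewrite starM sr.
rewrite (seminorm_star hA).
have := cnorm_star (a * r); rewrite starM sr -mulrA [star a * _]mulrA -/t.
have := cnormM r (t * r); have := seminorm_ge0 hA r.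
have := seminorm_ge0 hA (t * r); have := seminorm_ge0 hA (a * r).
move: (cnorm (r * (t * r))) (cnorm (a * r)) (cnorm (t * r)) (cnorm r) r1 tr.
move=> x y z w; nra.
Qed.

Definition ideal_dist a : R := inf [set cnorm (a - j) | j in J].
Local Notation p := ideal_dist.

Lemma ideal_dist_le a j : J j -> p a <= cnorm (a - j).
Proof.
move=> Jj; apply: ge_inf; last by exists j.
by exists 0 => _ [k _ <-]; exact: (seminorm_ge0 hA).
Qed.

Lemma ideal_dist_approx a (e : R) : 0 < e -> exists2 j, J j & cnorm (a - j) < p a + e.
Proof.
move=> e0; have [|_ [j Jj <-] h] := @inf_adherent R [set cnorm (a - j) | j in J] _ e0.
  split; first by exists (cnorm (a - 0)), 0 => //; exact: ideal0.
  by exists 0 => _ [k _ <-]; exact: (seminorm_ge0 hA).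
by exists j.
Qed.

Lemma ideal_dist_geM a (m c : R) : 0 <= c ->
  (forall j, J j -> m <= c * cnorm (a - j)) -> m <= c * p a.
Proof.
move=> c0 h; apply/ler_addgt0Pr => e e0; have c1 : 0 < c + 1 by lra.
have [j Jj hj] := @ideal_dist_approx a (e / (c + 1)) ltac:(by rewrite divr_gt0).
apply: le_trans (h _ Jj) _; apply: le_trans (ler_wpM2l c0 (ltW hj)) _.
rewrite mulrDr lerD2l mulrCA -[leRHS]mulr1 ler_wpM2l ?(ltW e0) //.
by rewrite ler_pdivrMr // mul1r; lra.
Qed.

Lemma ideal_dist_ge a (m : R) : (forall j, J j -> m <= cnorm (a - j)) -> m <= p a.
Proof.
by move=> h; rewrite -[p a]mul1r ideal_dist_geM // => j; rewrite mul1r; exact: h.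
Qed.

Lemma ideal_dist_ge0 a : 0 <= p a.
Proof. by apply: ideal_dist_ge => j _; exact: (seminorm_ge0 hA). Qed.

Lemma ideal_dist_eq0 a : p a = 0 <-> J a.
Proof.
split=> [a0|Ja]; last first.
  apply/eqP; rewrite eq_le ideal_dist_ge0 andbT.
  by have := ideal_dist_le a Ja; rewrite subrr (seminorm0 hA).
have [Jc _ _ _ _] := hJ; apply: Jc => e e0.
by have [j Jj] := @ideal_dist_approx a e e0; rewrite a0 add0r; exists j.
Qed.

(** The C*-identity is the point.  If [j] is replaced by its self-adjoint part
    [k], the distance from [star a * a] does not increase; compressing by [r],
    where [1 - r] is an approximate unit for [k], kills [k] up to [e], and [a r]
    is congruent to [a] modulo [J]. *)
Lemma ideal_dist_seminorm : cstar_seminorm (@star R A) p.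
Proof.
have pstar a : p (star a) <= p a.
  apply: ideal_dist_ge => j /ideal_star Jj; rewrite -(seminorm_star hA).
  by rewrite (seminorm_starB hA) ideal_dist_le.
have pM a b : p (a * b) <= p a * p b.
  apply: ideal_dist_geM => [|k Jk]; first exact: ideal_dist_ge0.
  rewrite mulrC; apply: ideal_dist_geM => [|j Jj]; first exact: (seminorm_ge0 hA).
  rewrite mulrC; apply: le_trans (cnormM _ _).
  rewrite -[(a - j) * _](subKr (a * b)); apply: ideal_dist_le.
  rewrite mulrBr opprB addrCA -mulrBl subKr.
  by apply: idealD; [exact: idealMl|exact: idealMr].
have pZ (c : R[i]) a : p (c *: a) <= normc c * p a.
  apply: ideal_dist_geM => [|j Jj]; first by case: (c) => ? ?; exact: sqrtr_ge0.
  by rewrite -(seminormZ hA) scalerBr ideal_dist_le //; exact: idealZ.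
split; [exact: starK|exact: starD|exact: starZ|exact: starM| | |exact: pM|].
- move=> a b; apply/ler_addgt0Pr => e e0.
  have [j Jj hj] := @ideal_dist_approx a (e / 2) ltac:(by rewrite divr_gt0).
  have [k Jk hk] := @ideal_dist_approx b (e / 2) ltac:(by rewrite divr_gt0).
  apply: le_trans (ideal_dist_le _ (idealD Jj Jk)) _.
  by rewrite opprD addrACA; have := cnormD (a - j) (b - k); lra.
- move=> c a; apply/eqP; rewrite eq_le pZ /=.
  have [->|c0] := eqVneq c 0; first by rewrite normc0 mul0r ideal_dist_ge0.
  have n0 : 0 < normc c.
    rewrite lt_def; case: (c) c0 => x y c0; rewrite sqrtr_ge0 andbT.
    by apply: contra_neq c0; exact: eq0_normc.
  have := pZ c^-1 (c *: a); rewrite scalerA mulVf // scale1r normcV mulrC.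
  by rewrite ler_pdivlMr // mulrC.
- move=> a; apply/eqP; rewrite eq_le; apply/andP; split.
    rewrite (le_trans (pM _ _)) // expr2 ler_wpM2r ?ideal_dist_ge0 //.
  apply: ideal_dist_ge => j Jj.
  pose k := (2^-1)%:C%C *: (j + star j).
  have Jk : J k by apply/idealZ/idealD => //; exact: ideal_star.
  have sk : star k = k by rewrite starZr starD starK addrC.
  have nk : cnorm (star a * a - k) <= cnorm (star a * a - j).
    have -> : star a * a - k =
        (2^-1)%:C%C *: ((star a * a - j) + star (star a * a - j)).
      rewrite (seminorm_starB hA) starM starK addrACA -opprD scalerBr.
      rewrite scalerDr -scalerDl -rmorphD /= (_ : 2^-1 + 2^-1 = 1 :> R).
        by rewrite scale1r.
      by lra.
    rewrite cnormZr ger0_norm //.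
    have := cnormD (star a * a - j) (star (star a * a - j)).
    by rewrite (seminorm_star hA); lra.
  apply: le_trans nk; apply/ler_addgt0Pr => e e0.
  have [r [sr r1 Jr tr]] := @ideal_approx_unit k e Jk sk e0.
  have h1 : p a ^+ 2 <= cnorm (r * (star a * a) * r).
    have -> : r * (star a * a) * r = star (a * r) * (a * r).
      by rewrite starM sr !mulrA.
    rewrite cnorm_star lerXn2r ?nnegrE ?ideal_dist_ge0 ?(seminorm_ge0 hA) //.
    have := ideal_dist_le a (idealMl a Jr).
    by rewrite mulrBr mulr1 opprB addrC subrK.
  apply: le_trans h1 _.
  have -> : r * (star a * a) * r = r * (star a * a - k) * r + r * (k * r).
    by rewrite mulrBr mulrBl !mulrA subrK.
  apply: le_trans (cnormD _ _) _; apply: lerD.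
    have := cnormM (r * (star a * a - k)) r; have := cnormM r (star a * a - k).
    have := seminorm_ge0 hA r; have := seminorm_ge0 hA (star a * a - k).
    have := seminorm_ge0 hA (r * (star a * a - k)).
    move: (cnorm _) (cnorm _) (cnorm _) (cnorm _) r1 => x y z w; nra.
  have := cnormM r (k * r); have := seminorm_ge0 hA r.
  have := seminorm_ge0 hA (k * r); nra.
Qed.

End IdealQuotient.

Section IdealQuotientExists.
Variables (R : realType) (A : cstarType R) (J : set A).
Hypothesis hJ : closed_ideal J.
Local Notation p := (ideal_dist J).
Let hA := @cnorm_seminorm R A.
Let hp := ideal_dist_seminorm hJ.

(** A subsequence whose successive distances to [J] are summable is corrected
    step by step by elements of [J] into a Cauchy sequence for the norm. *)
Lemma ideal_dist_complete : seminorm_complete p.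
Proof.
move=> u hu.
pose q : R := 2^-1; have q0 : 0 < q by rewrite /q invr_gt0.
have q01 : 0 <= q < 1 by rewrite ltW //= /q invf_lt1 // ltr1n.
have qn k : 0 < q ^+ k by exact: exprn_gt0.
have /choice[phi hphi] k : exists n0, forall m n,
    (n0 <= m)%N -> (n0 <= n)%N -> p (u m - u n) < q ^+ k.
  exact: hu.
have step k : p (u (phi k.+1) - u (phi k)) < q ^+ k *+ 2.
  pose M := maxn (phi k) (phi k.+1).
  have h1 := hphi k.+1 (phi k.+1) M (leqnn _) (leq_maxr _ _).
  have h2 := hphi k M (phi k) (leq_maxl _ _) (leqnn _).
  have := seminorm_distD hp (u M) (u (phi k.+1)) (u (phi k)).
  rewrite exprS in h1; have := qn k; case/andP: q01 => _ q1; rewrite mulr2n; nra.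
have /choice[j hj] k : exists j, J j /\
    cnorm (u (phi k.+1) - u (phi k) - j) < q ^+ k *+ 2.
  have := @ideal_dist_approx _ _ _ hJ (u (phi k.+1) - u (phi k))
    (q ^+ k *+ 2 - p (u (phi k.+1) - u (phi k))).
  by rewrite subr_gt0 => /(_ (step k))[j Jj]; rewrite [X in _ < X]addrC subrK; exists j.
pose v := fix v k := if k is k'.+1
  then v k' + (u (phi k'.+1) - u (phi k') - j k') else u (phi 0%N).
have Jv k : J (v k - u (phi k)).
  elim: k => [|k IH] /=; first by rewrite subrr; exact: ideal0.
  have -> : v k + (u (phi k.+1) - u (phi k) - j k) - u (phi k.+1) =
      (v k - u (phi k)) - j k.
    by rewrite -!addrA; congr (_ + _); rewrite addrC -!addrA addNr addr0.
  by apply: (idealB hJ) => //; case: (hj k).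
have [k|l hl] := @cnorm_geometric_cvg R A v q 2 q01.
  by rewrite /= [v k + _]addrC addrK mulr_natr ltW //; case: (hj k).
exists l => e e0; have e2 : 0 < e / 2 by rewrite divr_gt0.
have [n1 hn1] := expr_lt_eps q01 (ler01 : 0 <= 1 :> R) e2.
have [n2 hn2] := hl _ e2; pose k := maxn n1 n2.
exists (phi k) => n hn.
have h1 := hphi k n (phi k) hn (leqnn _).
have h2 := hn1 k (leq_maxl _ _); rewrite mulr1 in h2.
have h3 := hn2 k (leq_maxr _ _).
have h4 : p (u (phi k) - v k) = 0.
  by rewrite (seminorm_distC hp); apply/(ideal_dist_eq0 hJ)/Jv.
have h5 : p (v k - l) <= cnorm (v k - l).
  by have := ideal_dist_le (v k - l) (ideal0 hJ); rewrite subr0.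
have := seminorm_distD hp (u (phi k)) (u n) l.
by have := seminorm_distD hp (v k) (u (phi k)) l; lra.
Qed.

Theorem cstar_ideal_quotient : ~ J 1 ->
  exists (B : cstarType R) (f : A -> B),
    [/\ star_hom f, forall b, exists a, b = f a & forall a, f a = 0 <-> J a].
Proof.
move=> J1; have p1 : p 1 != 0 by apply/eqP => /(ideal_dist_eq0 hJ).
have [B [f [fL fM f1 [fS fsurj fp]]]] :=
  cstar_separated_quotient hp p1 ideal_dist_complete.
exists B, f; split=> // a; rewrite -(ideal_dist_eq0 hJ) -fp; split=> [->|].
  exact: (seminorm0 (@cnorm_seminorm R B)).
exact: cnorm0_eq0.
Qed.

End IdealQuotientExists.

(** * Completion of a C*-seminormed algebra *)

Section Completion.
Variables (R : realType) (X : algType R[i]) (st : X -> X) (p : X -> R).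
Hypotheses (hp : cstar_seminorm st p) (p1 : p 1 != 0).

Definition cauchy_seq (u : nat -> X) : Prop :=
  forall e : R, 0 < e -> exists n0, forall m n,
    (n0 <= m)%N -> (n0 <= n)%N -> p (u m - u n) < e.

Lemma cauchy_seq_cst a : cauchy_seq (fun=> a).
Proof. by move=> e e0; exists 0%N => m n _ _; rewrite subrr (seminorm0 hp). Qed.

Lemma cauchy_seqD u v : cauchy_seq u -> cauchy_seq v -> cauchy_seq (fun n => u n + v n).
Proof.
move=> hu hv e e0; have e2 : 0 < e / 2 by rewrite divr_gt0.
have [[n1 h1] [n2 h2]] := conj (hu _ e2) (hv _ e2).
exists (maxn n1 n2) => m n; rewrite !geq_max => /andP[m1 m2] /andP[k1 k2].
have := h1 m n m1 k1; have := h2 m n m2 k2.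
by rewrite opprD addrACA; have := seminormD hp (u m - u n) (v m - v n); lra.
Qed.

Lemma cauchy_seq_bound u : cauchy_seq u ->
  exists2 C : R, 0 < C & exists n0, forall n, (n0 <= n)%N -> p (u n) < C.
Proof.
move=> /(_ 1 ltr01)[n0 h]; have := seminorm_ge0 hp (u n0).
exists (p (u n0) + 1); first by lra.
exists n0 => n hn; have := h n n0 hn (leqnn _).
by have := seminorm_distD hp (u n0) (u n) 0; rewrite !subr0; lra.
Qed.

Lemma cauchy_seqM u v : cauchy_seq u -> cauchy_seq v -> cauchy_seq (fun n => u n * v n).
Proof.
move=> hu hv e e0.
have [C C0 [n3 hC]] := cauchy_seq_bound hu; have [D D0 [n4 hD]] := cauchy_seq_bound hv.
have [n1 h1] := hu (e / (2 * D)) ltac:(by rewrite divr_gt0 ?mulr_gt0).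
have [n2 h2] := hv (e / (2 * C)) ltac:(by rewrite divr_gt0 ?mulr_gt0).
exists (maxn (maxn n1 n2) (maxn n3 n4)) => m n.
rewrite !geq_max => /andP[/andP[m1 m2] /andP[m3 m4]] /andP[/andP[k1 k2] /andP[k3 k4]].
have -> : u m * v m - u n * v n = u m * (v m - v n) + (u m - u n) * v n.
  by rewrite mulrBr mulrBl addrA subrK.
have := h1 m n m1 k1; rewrite ltr_pdivlMr ?mulr_gt0 //.
have := h2 m n m2 k2; rewrite ltr_pdivlMr ?mulr_gt0 //.
have := hC m m3; have := hD n k4.
have := seminormM hp (u m) (v m - v n); have := seminormM hp (u m - u n) (v n).
have := seminormD hp (u m * (v m - v n)) ((u m - u n) * v n).
have := seminorm_ge0 hp (v m - v n); have := seminorm_ge0 hp (u m - u n).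
have := seminorm_ge0 hp (u m); have := seminorm_ge0 hp (v n).
move: (p (u m)) (p (v m - v n)) (p (u m - u n)) (p (v n)) => x y z w.
nra.
Qed.

Lemma cauchy_seqZ (c : R[i]) u : cauchy_seq u -> cauchy_seq (fun n => c *: u n).
Proof.
move=> hu; have := cauchy_seqM (cauchy_seq_cst c%:A) hu; congr cauchy_seq.
by apply/funext => n; rewrite -scalerAl mul1r.
Qed.

Lemma cauchy_seqN u : cauchy_seq u -> cauchy_seq (fun n => - u n).
Proof.
move=> /(cauchy_seqZ (-1)); congr cauchy_seq.
by apply/funext => n; rewrite scaleN1r.
Qed.

Lemma cauchy_seq_star u : cauchy_seq u -> cauchy_seq (fun n => st (u n)).
Proof.
move=> hu e /hu[n0 h]; exists n0 => m n hm hn.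
by rewrite -(seminorm_starB hp) (seminorm_star hp) h.
Qed.

(** Sequences are not identified when their difference tends to 0: the limit of
    the norms is a C*-seminorm, to which [cstar_separated_quotient] applies. *)
Definition cauchy_sequences (_ : cstar_seminorm st p) :=
  {u : nat -> X | `[< cauchy_seq u >]}.
Local Notation P := (cauchy_sequences hp).
HB.instance Definition _ := Choice.on P.

Definition mkcauchy u (hu : cauchy_seq u) : P := exist _ u (introT (asboolP _) hu).

Lemma cauchy_valP (u : P) : cauchy_seq (val u).
Proof. exact: (elimT (asboolP _) (valP u)). Qed.

Let cadd (u v : P) : P := mkcauchy (cauchy_seqD (cauchy_valP u) (cauchy_valP v)).
Let copp (u : P) : P := mkcauchy (cauchy_seqN (cauchy_valP u)).
Let cmul (u v : P) : P := mkcauchy (cauchy_seqM (cauchy_valP u) (cauchy_valP v)).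
Let cscale c (u : P) : P := mkcauchy (cauchy_seqZ c (cauchy_valP u)).
Let ccst a : P := mkcauchy (cauchy_seq_cst a).
Let cstar (u : P) : P := mkcauchy (cauchy_seq_star (cauchy_valP u)).

Let caddA : associative cadd.
Proof. by move=> u v w; apply/val_inj/funext => n /=; rewrite addrA. Qed.
Let caddC : commutative cadd.
Proof. by move=> u v; apply/val_inj/funext => n /=; rewrite addrC. Qed.
Let cadd0 : left_id (ccst 0) cadd.
Proof. by move=> u; apply/val_inj/funext => n /=; rewrite add0r. Qed.
Let caddN : left_inverse (ccst 0) copp cadd.
Proof. by move=> u; apply/val_inj/funext => n /=; rewrite addNr. Qed.
HB.instance Definition _ := GRing.isZmodule.Build P caddA caddC cadd0 caddN.

Let cmulA : associative cmul.
Proof. by move=> u v w; apply/val_inj/funext => n /=; rewrite mulrA. Qed.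
Let cmul1 : left_id (ccst 1) cmul.
Proof. by move=> u; apply/val_inj/funext => n /=; rewrite mul1r. Qed.
Let cmulr1 : right_id (ccst 1) cmul.
Proof. by move=> u; apply/val_inj/funext => n /=; rewrite mulr1. Qed.
Let cmulDl : left_distributive cmul cadd.
Proof. by move=> u v w; apply/val_inj/funext => n /=; rewrite mulrDl. Qed.
Let cmulDr : right_distributive cmul cadd.
Proof. by move=> u v w; apply/val_inj/funext => n /=; rewrite mulrDr. Qed.
Let c1_neq0 : ccst 1 != ccst 0.
Proof.
apply/eqP => /(congr1 (fun u : P => val u 0%N)) /= /eqP.
by rewrite (negPf (oner_neq0 X)).
Qed.
HB.instance Definition _ := GRing.Zmodule_isNzRing.Build P
  cmulA cmul1 cmulr1 cmulDl cmulDr c1_neq0.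

Let cscaleA c d u : cscale c (cscale d u) = cscale (c * d) u.
Proof. by apply/val_inj/funext => n /=; rewrite scalerA. Qed.
Let cscale1 : left_id 1 cscale.
Proof. by move=> u; apply/val_inj/funext => n /=; rewrite scale1r. Qed.
Let cscaleDr : right_distributive cscale +%R.
Proof. by move=> c u v; apply/val_inj/funext => n /=; rewrite scalerDr. Qed.
Let cscaleDl u : {morph cscale^~ u : c d / c + d}.
Proof. by move=> c d; apply/val_inj/funext => n /=; rewrite scalerDl. Qed.
HB.instance Definition _ := GRing.Zmodule_isLmodule.Build R[i] P
  cscaleA cscale1 cscaleDr cscaleDl.
Let cscaleAl c (u v : P) : c *: (u * v) = c *: u * v.
Proof. by apply/val_inj/funext => n /=; rewrite scalerAl. Qed.
HB.instance Definition _ := GRing.Lmodule_isLalgebra.Build R[i] P cscaleAl.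
Let cscaleAr c (u v : P) : c *: (u * v) = u * (c *: v).
Proof. by apply/val_inj/funext => n /=; rewrite scalerAr. Qed.
HB.instance Definition _ := GRing.Lalgebra_isAlgebra.Build R[i] P cscaleAr.

Let clim (u : P) : R := lim ((fun n => p (val u n)) @ \oo).

Let climP (u : P) : (fun n => p (val u n)) @ \oo --> clim u.
Proof.
apply/cauchy_cvgP/cauchyP => e /(cauchy_valP u)[n0 h].
exists (p (val u n0)), n0 => // n /= hn.
rewrite /ball /= ltr_norml; have := h n0 n (leqnn _) hn.
have := seminormD hp (val u n0 - val u n) (val u n).
have := seminormD hp (val u n - val u n0) (val u n0).
rewrite !subrK (seminorm_distC hp (val u n)); lra.
Qed.

Let clim_le (u : P) (c : R) n0 :
  (forall n, (n0 <= n)%N -> p (val u n) <= c) -> clim u <= c.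
Proof.
move=> h; apply: (ler_cvg_to (@climP u)); first exact: cvg_cst.
by exists n0.
Qed.

Let clim_seminorm : cstar_seminorm cstar clim.
Proof.
split=> [u|u v|c u|u v|u v|c u|u v|u]; try (by apply/val_inj/funext => n /=;
  rewrite ?(seminorm_starK hp, seminorm_starD hp, seminorm_starZ hp,
    seminorm_starM hp)).
- apply: (ler_cvg_to (@climP _) (cvgD (@climP u) (@climP v))).
  by apply: nearW => n; exact: (seminormD hp).
- apply: (cvg_unique _ (@climP _)) => //=.
  rewrite (_ : (fun n => _) = (fun n => normc c * p (val u n))).
    exact: cvgMl_tmp (@climP u).
  by apply/funext => n; rewrite (seminormZ hp).
- apply: (ler_cvg_to (@climP _) (cvgM (@climP u) (@climP v))).
  by apply: nearW => n; exact: (seminormM hp).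
- apply: (cvg_unique _ (@climP _)) => //=.
  rewrite (_ : (fun n => _) = (fun n => p (val u n) * p (val u n))) ?expr2.
    exact: cvgM (@climP u) (@climP u).
  by apply/funext => n; rewrite (seminorm_star_mul hp).
Qed.

Let clim_lt (u : P) (c : R) : clim u < c ->
  exists n0, forall n, (n0 <= n)%N -> p (val u n) < c.
Proof.
rewrite -subr_gt0 => c0; have /cvgrPdist_lt/(_ _ c0)[n0 _ h] := @climP u.
by exists n0 => n /h /=; rewrite ltr_norml; lra.
Qed.

(** Diagonal argument: [v k] is a term of [U k] from which on [U k] varies by
    less than [2^-k]. *)
Let clim_complete : seminorm_complete clim.
Proof.
move=> U hU; pose q : R := 2^-1.
have q01 : 0 <= q < 1 by rewrite /q invr_ge0 ler0n invf_lt1 // ltr1n.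
have q0 k : 0 < q ^+ k by rewrite exprn_gt0 // invr_gt0.
have /choice[m hm] k : exists n0, forall i j, (n0 <= i)%N -> (n0 <= j)%N ->
    p (val (U k) i - val (U k) j) < q ^+ k by exact: (cauchy_valP (U k)).
pose v k := val (U k) (m k).
have small (e : R) : 0 < e -> exists n0, forall n, (n0 <= n)%N -> q ^+ n < e.
  by move=> /(expr_lt_eps q01 ler01)[n0 h]; exists n0 => n /h; rewrite mulr1.
have hv : cauchy_seq v.
  move=> e e0; have e3 : 0 < e / 3 by rewrite divr_gt0.
  have [n1 h1] := small _ e3; have [n2 h2] := hU _ e3.
  exists (maxn n1 n2) => k l; rewrite !geq_max => /andP[k1 k2] /andP[l1 l2].
  have [n3 h3] := clim_lt (h2 k l k2 l2).
  pose n := maxn n3 (maxn (m k) (m l)).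
  have a1 := h3 n (leq_maxl _ _); rewrite /= in a1.
  have a2 := hm k (m k) n (leqnn _)
    (leq_trans (leq_maxl _ (m l)) (leq_maxr n3 _)).
  have a3 := hm l n (m l)
    (leq_trans (leq_maxr (m k) _) (leq_maxr n3 _)) (leqnn _).
  have := h1 k k1; have := h1 l l1.
  have := seminorm_distD hp (val (U k) n) (v k) (v l).
  have := seminorm_distD hp (val (U l) n) (val (U k) n) (v l).
  rewrite -/(v k) in a2; rewrite -/(v l) in a3; lra.
exists (mkcauchy hv) => e e0; have e3 : 0 < e / 3 by rewrite divr_gt0.
have [n1 h1] := small _ e3; have [n2 h2] := hv _ e3.
exists (maxn n1 n2) => k; rewrite geq_max => /andP[k1 k2].
apply: (@le_lt_trans _ _ (e / 3 + e / 3)); last by lra.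
apply: (@clim_le _ _ (maxn n2 (m k))) => n /=; rewrite geq_max => /andP[n2' nk].
have := hm k n (m k) nk (leqnn _); have := h1 k k1; have := h2 k n k2 n2'.
have := seminorm_distD hp (v k) (val (U k) n) (v n).
rewrite -/(v k); lra.
Qed.

Theorem cstar_completion : exists (B : cstarType R) (f : X -> B),
  [/\ forall (c : R[i]) a b, f (c *: a + b) = c *: f a + f b,
      {morph f : a b / a * b}, f 1 = 1, forall a, f (st a) = star (f a)
    & forall a, cnorm (f a) = p a].
Proof.
have cst_lim a : clim (ccst a) = p a.
  by apply: (cvg_unique _ (@climP _)) => //=; exact: cvg_cst.
have clim1 : clim 1 != 0 by rewrite -[1]/(ccst 1) cst_lim.
have [B [f [fL fM f1 [fS _ fp]]]] :=
  cstar_separated_quotient clim_seminorm clim1 clim_complete.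
exists B, (f \o ccst); split=> /= [c a b|a b||a|a].
- by rewrite -fL; congr f; apply/val_inj/funext.
- by rewrite -fM; congr f; apply/val_inj/funext.
- by rewrite -f1.
- by rewrite -fS; congr f; apply/val_inj/funext.
- by rewrite fp.
Qed.

End Completion.

(** * The C*-algebra generated by adjointable operators *)

Local Notation Re := complex.Re.

Record semi_inner_product (R : realType) (E : lmodType R[i])
    (ip : E -> E -> R[i]) : Prop := SemiInnerProduct {
  ip_linear : forall (c : R[i]) a b d, ip (c *: a + b) d = c * ip a d + ip b d;
  ip_conj : forall a b, ip b a = (ip a b)^*;
  ip_ge0 : forall a, 0 <= ip a a }.

Section SemiInnerProduct.
Variables (R : realType) (E : lmodType R[i]) (ip : E -> E -> R[i]).
Hypothesis hE : semi_inner_product ip.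
Implicit Types (a b d : E) (s : R) (c : R[i]).

Lemma Re_conj (z : R[i]) : Re z^* = Re z.
Proof. by rewrite -[z^*]/(conjc z); case: z. Qed.

Lemma Re_realM s (z : R[i]) : Re (s%:C%C * z) = s * Re z.
Proof. by case: z => x y; rewrite /= mul0r subr0. Qed.

Lemma ReD (z w : R[i]) : Re (z + w) = Re z + Re w.
Proof. by case: z w => [? ?] [? ?]. Qed.

Definition re_ip a b : R := Re (ip a b).

Lemma re_ipC a b : re_ip a b = re_ip b a.
Proof. by rewrite /re_ip (ip_conj hE a b) Re_conj. Qed.

Lemma re_ipDl a b d : re_ip (a + b) d = re_ip a d + re_ip b d.
Proof. by rewrite /re_ip -{1}[a]scale1r (ip_linear hE) mul1r ReD. Qed.

Lemma ip0l d : ip 0 d = 0.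
Proof.
apply: (addrI (ip 0 d)); rewrite addr0 -{1}[ip 0 d]mul1r -(ip_linear hE).
by rewrite scaler0 addr0.
Qed.

Lemma ipZl c a d : ip (c *: a) d = c * ip a d.
Proof. by rewrite -[c *: a]addr0 (ip_linear hE) ip0l addr0. Qed.

Lemma re_ipZl s a d : re_ip (s%:C%C *: a) d = s * re_ip a d.
Proof. by rewrite /re_ip ipZl Re_realM. Qed.

Lemma re_ip_ge0 a : 0 <= re_ip a a.
Proof. by have := ip_ge0 hE a; rewrite lecE => /andP[]. Qed.

Definition vnorm a : R := Num.sqrt (re_ip a a).

Lemma vnorm_ge0 a : 0 <= vnorm a. Proof. exact: sqrtr_ge0. Qed.

Lemma vnorm_sq a : vnorm a ^+ 2 = re_ip a a.
Proof. exact/sqr_sqrtr/re_ip_ge0. Qed.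

(** The quadratic polynomial [s |-> |a - s b|^2] is evaluated at its minimum,
    or, when [b] has norm zero, at a point where it would be negative. *)
Lemma cauchy_schwarz a b : re_ip a b <= vnorm a * vnorm b.
Proof.
have q s : 0 <= re_ip a a - 2 * s * re_ip a b + s ^+ 2 * re_ip b b.
  have := re_ip_ge0 (a + (- s)%:C%C *: b).
  rewrite re_ipDl !(re_ipC _ (_ + _)) !re_ipDl re_ipZl.
  rewrite (re_ipC a (_ *: b)) !re_ipZl (re_ipC b (_ *: b)) re_ipZl (re_ipC b a).
  by congr (_ <= _); ring.
have := vnorm_ge0 a; have := vnorm_ge0 b; rewrite -!vnorm_sq in q.
move: (vnorm a) (vnorm b) (re_ip a b) q => x y z q y0 x0.
have [y1|y1] := eqVneq y 0.
  rewrite y1 mulr0; case: leP => // z0.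
  have := q ((x ^+ 2 + 1) / (2 * z)); rewrite y1 expr0n /= mulr0 addr0.
  have -> : 2 * ((x ^+ 2 + 1) / (2 * z)) * z = x ^+ 2 + 1.
    by field; rewrite gt_eqF.
  lra.
have {}y0 : 0 < y by rewrite lt_def y1.
have := q (z / y ^+ 2).
have -> : x ^+ 2 - 2 * (z / y ^+ 2) * z + (z / y ^+ 2) ^+ 2 * y ^+ 2 =
    (x ^+ 2 * y ^+ 2 - z ^+ 2) / y ^+ 2 by field.
rewrite pmulr_lge0 ?invr_gt0 ?exprn_gt0 // -exprMn subr_ge0 => h.
have xy : 0 <= x * y by rewrite mulr_ge0 // ltW.
case: (leP z 0) => z0; first exact: le_trans z0 xy.
by rewrite -(@ler_pXn2r _ 2) ?nnegrE // ltW.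
Qed.

Lemma vnormD a b : vnorm (a + b) <= vnorm a + vnorm b.
Proof.
rewrite -(@ler_pXn2r _ 2) ?nnegrE ?addr_ge0 ?vnorm_ge0 // vnorm_sq.
rewrite re_ipDl !(re_ipC _ (_ + _)) !re_ipDl -!vnorm_sq (re_ipC b a).
have := cauchy_schwarz a b; rewrite sqrrD mulr2n; lra.
Qed.

Lemma vnormZ c a : vnorm (c *: a) = normc c * vnorm a.
Proof.
have n0 : 0 <= normc c by case: (c) => ? ?; exact: sqrtr_ge0.
apply/eqP; rewrite -(@eqrXn2 _ 2) ?mulr_ge0 ?vnorm_ge0 // exprMn !vnorm_sq.
rewrite /re_ip ipZl (ip_conj hE _ a) ipZl rmorphM /= -(ip_conj hE a a) mulrA.
by rewrite -normCK -normc_normE -rmorphXn /= Re_realM.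
Qed.

(** The adjoint is part of the data, since a bounded operator on an incomplete
    space may have no adjoint. *)
Definition adjoint_pair (TS : (E -> E) * (E -> E)) : Prop :=
  [/\ linear TS.1, linear TS.2, forall a b, ip (TS.1 a) b = ip a (TS.2 b),
      exists2 C : R, 0 <= C & forall a, vnorm (TS.1 a) <= C * vnorm a
    & exists2 C : R, 0 <= C & forall a, vnorm (TS.2 a) <= C * vnorm a].

End SemiInnerProduct.

Section Operators.
Variables (R : realType) (E : lmodType R[i]) (ip : E -> E -> R[i]) (e0 : E).
Hypotheses (hE : semi_inner_product ip) (he : ip e0 e0 != 0).
Local Notation adjoint_pair := (@adjoint_pair R E ip).
Local Notation vnorm := (vnorm ip).
Implicit Types (T S : E -> E) (a b : E).

Lemma adjoint_pair_sym T S : adjoint_pair (T, S) -> adjoint_pair (S, T).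
Proof.
case=> /= hT hS hTS CT CS; split=> //= a b.
by rewrite (ip_conj hE b) -hTS -(ip_conj hE).
Qed.

Lemma adjoint_pair1 : adjoint_pair (id, id).
Proof. by split=> //=; exists 1 => // a; rewrite mul1r. Qed.

Lemma adjoint_pairM T S T' S' : adjoint_pair (T, S) -> adjoint_pair (T', S') ->
  adjoint_pair (T \o T', S' \o S).
Proof.
case=> /= hT hS hTS [C C0 hC] [D D0 hD] [/= hT' hS' hTS' [C' C0' hC'] [D' D0' hD']].
split=> /= [c a b /=|c a b /=|a b||].
- by rewrite hT' hT.
- by rewrite hS hS'.
- by rewrite hTS hTS'.
- exists (C * C') => [|a]; first exact: mulr_ge0.
  by rewrite (le_trans (hC _)) // -mulrA ler_wpM2l.
- exists (D' * D) => [|a]; first exact: mulr_ge0.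
  by rewrite (le_trans (hD' _)) // -mulrA ler_wpM2l.
Qed.

Lemma adjoint_pairD T S T' S' : adjoint_pair (T, S) -> adjoint_pair (T', S') ->
  adjoint_pair (fun a => T a + T' a, fun a => S a + S' a).
Proof.
case=> /= hT hS hTS [C C0 hC] [D D0 hD] [/= hT' hS' hTS' [C' C0' hC'] [D' D0' hD']].
split=> /= [c a b /=|c a b /=|a b||].
- by rewrite hT hT' scalerDr addrACA.
- by rewrite hS hS' scalerDr addrACA.
- rewrite -[T a]scale1r (ip_linear hE) mul1r (ip_conj hE _ a).
  rewrite -[S b]scale1r (ip_linear hE) mul1r rmorphD /= -!(ip_conj hE).
  by rewrite hTS hTS'.
- exists (C + C') => [|a]; first exact: addr_ge0.
  by rewrite (le_trans (vnormD hE _ _)) // mulrDl lerD.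
- exists (D + D') => [|a]; first exact: addr_ge0.
  by rewrite (le_trans (vnormD hE _ _)) // mulrDl lerD.
Qed.

Lemma normc_ge0 (c : R[i]) : 0 <= normc c.
Proof. by case: c => ? ?; exact: sqrtr_ge0. Qed.

Lemma adjoint_pairZ (c : R[i]) T S : adjoint_pair (T, S) ->
  adjoint_pair (fun a => c *: T a, fun a => c^* *: S a).
Proof.
case=> /= hT hS hTS [C C0 hC] [D D0 hD].
split=> /= [d a b /=|d a b /=|a b||].
- by rewrite hT scalerDr !scalerA mulrC.
- by rewrite hS scalerDr !scalerA mulrC.
- rewrite (ipZl hE) (ip_conj hE _ a) (ipZl hE) rmorphM /= conjCK.
  by rewrite -(ip_conj hE) hTS.
- exists (normc c * C) => [|a]; first by rewrite mulr_ge0 ?normc_ge0.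
  by rewrite (vnormZ hE) -mulrA ler_wpM2l ?normc_ge0.
- exists (normc c^* * D) => [|a]; first by rewrite mulr_ge0 ?normc_ge0.
  by rewrite (vnormZ hE) -mulrA ler_wpM2l ?normc_ge0.
Qed.

Lemma adjoint_pairN T S : adjoint_pair (T, S) ->
  adjoint_pair (fun a => - T a, fun a => - S a).
Proof.
move=> /(adjoint_pairZ (-1)); congr (adjoint_pair (_, _)).
  by apply/funext => a; rewrite scaleN1r.
by apply/funext => a; rewrite rmorphN rmorph1 scaleN1r.
Qed.

Lemma adjoint_pair0 : adjoint_pair (fun=> 0, fun=> 0).
Proof.
have := adjoint_pairZ 0 adjoint_pair1; congr (adjoint_pair (_, _)).
  by apply/funext => a; rewrite scale0r.
by apply/funext => a; rewrite rmorph0 scale0r.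
Qed.

Definition operator (_ : semi_inner_product ip) (_ : ip e0 e0 != 0) :=
  {TS : (E -> E) * (E -> E) | `[< adjoint_pair TS >]}.
Local Notation X := (operator hE he).
HB.instance Definition _ := Choice.on X.

Definition mkop TS (h : adjoint_pair TS) : X := exist _ TS (introT (asboolP _) h).
Definition opfun (t : X) : E -> E := (val t).1.
Definition opadj (t : X) : E -> E := (val t).2.

Lemma opP (t : X) : adjoint_pair (opfun t, opadj t).
Proof. by rewrite -surjective_pairing; exact: (elimT (asboolP _) (valP t)). Qed.

Lemma op_inj (t t' : X) : opfun t =1 opfun t' -> opadj t =1 opadj t' -> t = t'.
Proof.
move=> h1 h2; apply: val_inj; rewrite [LHS]surjective_pairing.
by rewrite [RHS]surjective_pairing; congr (_, _); apply/funext.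
Qed.

Let oadd t t' : X := mkop (adjoint_pairD (opP t) (opP t')).
Let oopp t : X := mkop (adjoint_pairN (opP t)).
Let omul t t' : X := mkop (adjoint_pairM (opP t) (opP t')).
Let oscale c t : X := mkop (adjoint_pairZ c (opP t)).
Let ostar t : X := mkop (adjoint_pair_sym (opP t)).
Let o0 : X := mkop adjoint_pair0.
Let o1 : X := mkop adjoint_pair1.

Let oaddA : associative oadd.
Proof. by move=> u v w; apply: op_inj => a; rewrite /opfun /opadj /= addrA. Qed.
Let oaddC : commutative oadd.
Proof. by move=> u v; apply: op_inj => a; rewrite /opfun /opadj /= addrC. Qed.
Let oadd0 : left_id o0 oadd.
Proof. by move=> u; apply: op_inj => a; rewrite /opfun /opadj /= add0r. Qed.
Let oaddN : left_inverse o0 oopp oadd.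
Proof. by move=> u; apply: op_inj => a; rewrite /opfun /opadj /= addNr. Qed.
HB.instance Definition _ := GRing.isZmodule.Build X oaddA oaddC oadd0 oaddN.

Lemma opD (t : X) a b : opfun t (a + b) = opfun t a + opfun t b.
Proof. by case: (opP t) => /= h _ _ _ _; rewrite -[a]scale1r h !scale1r. Qed.
Lemma adjD (t : X) a b : opadj t (a + b) = opadj t a + opadj t b.
Proof. by case: (opP t) => /= _ h _ _ _; rewrite -[a]scale1r h !scale1r. Qed.
Lemma op0 (t : X) : opfun t 0 = 0.
Proof. by apply: (addrI (opfun t 0)); rewrite -opD !addr0. Qed.
Lemma adj0 (t : X) : opadj t 0 = 0.
Proof. by apply: (addrI (opadj t 0)); rewrite -adjD !addr0. Qed.
Lemma opZ (t : X) c a : opfun t (c *: a) = c *: opfun t a.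
Proof. by case: (opP t) => /= h _ _ _ _; rewrite -[c *: a]addr0 h op0 addr0. Qed.
Lemma adjZ (t : X) c a : opadj t (c *: a) = c *: opadj t a.
Proof. by case: (opP t) => /= _ h _ _ _; rewrite -[c *: a]addr0 h adj0 addr0. Qed.

Let omulA : associative omul.
Proof. by move=> u v w; apply: op_inj. Qed.
Let omul1 : left_id o1 omul.
Proof. by move=> u; apply: op_inj. Qed.
Let omulr1 : right_id o1 omul.
Proof. by move=> u; apply: op_inj. Qed.
Let omulDl : left_distributive omul oadd.
Proof.
by move=> u v w; apply: op_inj => a; rewrite /opfun /opadj /= -/(opadj w) ?adjD.
Qed.
Let omulDr : right_distributive omul oadd.
Proof.
by move=> u v w; apply: op_inj => a; rewrite /opfun /opadj /= -/(opfun u) ?opD.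
Qed.

Lemma vnorm_e0 : 0 < vnorm e0.
Proof.
rewrite lt_def vnorm_ge0 andbT; apply: contra_neq he => h.
apply/eqP; rewrite eq_complex /= -[complex.Re _]/(re_ip ip e0 e0).
rewrite -(vnorm_sq hE) h expr0n eqxx /=.
by have := ip_ge0 hE e0; rewrite lecE => /andP[].
Qed.

Lemma vnorm0 : vnorm 0 = 0.
Proof. by rewrite -(scale0r 0) (vnormZ hE) normc0 mul0r. Qed.

Let o1_neq0 : o1 != o0.
Proof.
apply/eqP => /(congr1 (fun t => vnorm (opfun t e0))).
by rewrite /opfun /= vnorm0 => h; have := vnorm_e0; rewrite h ltxx.
Qed.
HB.instance Definition _ := GRing.Zmodule_isNzRing.Build X
  omulA omul1 omulr1 omulDl omulDr o1_neq0.

Let oscaleA c d t : oscale c (oscale d t) = oscale (c * d) t.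
Proof. by apply: op_inj => a; rewrite /opfun /opadj /= scalerA // rmorphM. Qed.
Let oscale1 : left_id 1 oscale.
Proof. by move=> u; apply: op_inj => a; rewrite /opfun /opadj /= ?rmorph1 scale1r. Qed.
Let oscaleDr : right_distributive oscale +%R.
Proof. by move=> c u v; apply: op_inj => a; rewrite /opfun /opadj /= scalerDr. Qed.
Let oscaleDl t : {morph oscale^~ t : c d / c + d}.
Proof. by move=> c d; apply: op_inj => a; rewrite /opfun /opadj /= ?rmorphD scalerDl. Qed.
HB.instance Definition _ := GRing.Zmodule_isLmodule.Build R[i] X
  oscaleA oscale1 oscaleDr oscaleDl.
Let oscaleAl c (u v : X) : c *: (u * v) = c *: u * v.
Proof. by apply: op_inj => a; rewrite /opfun /opadj /= -/(opadj v) ?adjZ. Qed.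
HB.instance Definition _ := GRing.Lmodule_isLalgebra.Build R[i] X oscaleAl.
Let oscaleAr c (u v : X) : c *: (u * v) = u * (c *: v).
Proof. by apply: op_inj => a; rewrite /opfun /opadj /= -/(opfun u) ?opZ. Qed.
HB.instance Definition _ := GRing.Lalgebra_isAlgebra.Build R[i] X oscaleAr.

Definition opnorm (t : X) : R :=
  inf [set C : R | 0 <= C /\ forall a, vnorm (opfun t a) <= C * vnorm a].

Lemma opnorm_le t (C : R) : 0 <= C -> (forall a, vnorm (opfun t a) <= C * vnorm a) ->
  opnorm t <= C.
Proof. by move=> C0 hC; apply: ge_inf; [exists 0 => ? []|]. Qed.

Lemma opnorm_has_inf t :
  has_inf [set C : R | 0 <= C /\ forall a, vnorm (opfun t a) <= C * vnorm a].
Proof.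
split; last by exists 0 => ? [].
by have [_ _ _ [C C0 hC] _] := opP t; exists C.
Qed.

Lemma opnorm_ge0 t : 0 <= opnorm t.
Proof. by have [? ?] := opnorm_has_inf t; apply: lb_le_inf => // ? []. Qed.

Lemma opnormP t a : vnorm (opfun t a) <= opnorm t * vnorm a.
Proof.
apply/ler_addgt0Pr => e e1; have v0 := vnorm_ge0 ip a.
have d0 : 0 < vnorm a + 1 by lra.
have [C [C0 hC] h] := inf_adherent
  (ltac:(by rewrite divr_gt0) : 0 < e / (vnorm a + 1)) (opnorm_has_inf t).
apply: le_trans (hC a) _; rewrite -/(opnorm t) in h.
apply: (@le_trans _ _ ((opnorm t + e / (vnorm a + 1)) * vnorm a)).
  by rewrite ler_wpM2r // ltW.
rewrite mulrDl lerD2l -mulrA -[leRHS]mulr1 ler_wpM2l ?(ltW e1) //.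
by rewrite mulrC ler_pdivrMr // mul1r; lra.
Qed.

Let opnorm_star_le t : opnorm t ^+ 2 <= opnorm (ostar t * t).
Proof.
rewrite -[leRHS]sqr_sqrtr ?opnorm_ge0 //.
rewrite ler_pXn2r ?nnegrE ?opnorm_ge0 ?sqrtr_ge0 //.
apply: opnorm_le => [|a]; first exact: sqrtr_ge0.
rewrite -(@ler_pXn2r _ 2) ?nnegrE ?mulr_ge0 ?sqrtr_ge0 // exprMn.
rewrite (sqr_sqrtr (opnorm_ge0 _)) (vnorm_sq hE).
have -> : re_ip ip (opfun t a) (opfun t a) = re_ip ip a (opfun (ostar t * t) a).
  by rewrite /re_ip; case: (opP t) => /= _ _ -> _ _.
rewrite (le_trans (cauchy_schwarz hE _ _)) // expr2.
have := opnormP (ostar t * t) a; have := vnorm_ge0 ip a; nra.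
Qed.

Let opnormM t t' : opnorm (t * t') <= opnorm t * opnorm t'.
Proof.
apply: opnorm_le => [|a]; first by rewrite mulr_ge0 ?opnorm_ge0.
rewrite (le_trans (opnormP t _)) // -mulrA ler_wpM2l ?opnorm_ge0 //.
exact: opnormP.
Qed.

Lemma opnorm_seminorm : cstar_seminorm ostar opnorm.
Proof.
have star_le t : opnorm t <= opnorm (ostar t).
  have [->|/eqP t0] := eqVneq (opnorm t) 0; first exact: opnorm_ge0.
  have := le_trans (opnorm_star_le t) (opnormM _ _).
  by rewrite expr2 ler_pM2r // lt_def opnorm_ge0 andbT; apply/eqP.
have ostarK : involutive ostar by move=> t; apply: op_inj.
have leZ c t : opnorm (c *: t) <= normc c * opnorm t.
  apply: opnorm_le => [|a]; first by rewrite mulr_ge0 ?normc_ge0 ?opnorm_ge0.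
  by rewrite (vnormZ hE) -mulrA ler_wpM2l ?normc_ge0 // opnormP.
split=> [//|t t'|c t|t t'|t t'|c t|//|t].
- by apply: op_inj.
- by apply: op_inj => a; rewrite /opfun /opadj //= conjCK.
- by apply: op_inj.
- apply: opnorm_le => [|a]; first by rewrite addr_ge0 ?opnorm_ge0.
  by rewrite (le_trans (vnormD hE _ _)) // mulrDl lerD // opnormP.
- apply/eqP; rewrite eq_le leZ /=.
  have [->|c0] := eqVneq c 0; first by rewrite normc0 mul0r opnorm_ge0.
  have n0 : 0 < normc c.
    by rewrite lt_def normc_ge0 andbT; apply: contra_neq c0; exact: eq0_normc.
  have := leZ c^-1 (c *: t); rewrite scalerA mulVf // scale1r normcV mulrC.
  by rewrite ler_pdivlMr // mulrC.
- apply/eqP; rewrite eq_le opnorm_star_le andbT (le_trans (opnormM _ _)) //.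
  by rewrite expr2 ler_wpM2r ?opnorm_ge0 // -{2}(ostarK t).
Qed.

(** [L] carries no information outside adjoint pairs.  The last clause says that
    it is faithful, up to scalars and to vectors of norm zero. *)
Theorem cstar_of_operators : exists (B : cstarType R)
    (L : (E -> E) * (E -> E) -> B),
  [/\ forall T S T' S', adjoint_pair (T, S) -> adjoint_pair (T', S') ->
        L (T, S) * L (T', S') = L (T \o T', S' \o S),
      L (id, id) = 1 /\ L (-%R, -%R) = -1,
      forall T S, adjoint_pair (T, S) -> star (L (T, S)) = L (S, T)
    & forall (c : R[i]) T S T' S',
        adjoint_pair (T, S) -> adjoint_pair (T', S') ->
        L (T, S) = c *: L (T', S') -> forall a, vnorm (T a - c *: T' a) = 0].
Proof.
have n1 : opnorm 1 != 0.
  apply/eqP => h; have := opnormP 1 e0.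
  by rewrite h mul0r leNgt /opfun /= vnorm_e0.
have [B [f [fL fM f1 fS fp]]] := cstar_completion opnorm_seminorm n1.
pose L TS := f (insubd (1 : X) TS).
have LE T S (h : adjoint_pair (T, S)) : L (T, S) = f (mkop h).
  congr f; apply: val_inj; rewrite val_insubd.
  by case: ifP => // /negP[]; apply/asboolP.
have f0 : f 0 = 0 by have := fL (-1) 0 0; rewrite scaler0 addr0 scaleN1r addNr.
have fZ c t : f (c *: t) = c *: f t by rewrite -[c *: t]addr0 fL f0 addr0.
exists B, L; split=> [T S T' S' h h'||T S h|c T S T' S' h h' e a].
- rewrite (LE _ _ h) (LE _ _ h') (LE _ _ (adjoint_pairM h h')) -fM.
  by congr f; apply: op_inj.
- rewrite (LE _ _ adjoint_pair1) (LE _ _ (adjoint_pairN adjoint_pair1)) -f1.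
  split; first by congr f; apply: op_inj.
  by rewrite -scaleN1r -fZ; congr f; apply: op_inj => a; rewrite /opfun /opadj /=
    ?rmorphN ?rmorph1 scaleN1r.
- rewrite (LE _ _ h) (LE _ _ (adjoint_pair_sym h)) -fS.
  by congr f; apply: op_inj.
pose t := (- c) *: mkop h' + mkop h.
have t0 : opnorm t = 0.
  rewrite -fp fL -(LE _ _ h) -(LE _ _ h') e scaleNr addNr.
  exact: seminorm0 (@cnorm_seminorm R B).
apply/eqP; rewrite eq_le vnorm_ge0 andbT; have := opnormP t a.
by rewrite t0 mul0r /opfun /= scaleNr addrC.
Qed.

End Operators.

(** * Signed permutations as unitary elements of a C*-algebra *)

Section FiniteSupport.
Variables (R : realType) (G : choiceType).
Local Notation C := R[i].

Definition finsupp : Type :=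
  {f : G -> C | `[< finite_set [set t | f t != 0] >]}.
HB.instance Definition _ := Choice.on finsupp.

Lemma finsuppP (f : finsupp) : finite_set [set t | val f t != 0].
Proof. exact: (elimT (asboolP _) (valP f)). Qed.

Definition mkfinsupp f (h : finite_set [set t | f t != 0]) : finsupp :=
  exist _ f (introT (asboolP _) h).

Lemma finite_supp_lin (c : C) (f g : finsupp) :
  finite_set [set t | c * val f t + val g t != 0].
Proof.
apply: (@sub_finite_set _ _ ([set t | val f t != 0] `|` [set t | val g t != 0])).
  move=> t /=; apply: contraPP => /not_orP[/negP/negPn/eqP-> /negP/negPn/eqP->].
  by apply/negP/negPn; rewrite mulr0 addr0.
by rewrite finite_setU; split; exact: finsuppP.
Qed.

Lemma finite_supp0 : finite_set [set t : G | (0 : C) != 0].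
Proof. by rewrite (_ : [set _ | _] = set0) // -subset0 => t /=; rewrite eqxx. Qed.

Let fs0 : finsupp := mkfinsupp finite_supp0.
Let lin_c (c : C) (f g : finsupp) : finsupp := mkfinsupp (finite_supp_lin c f g).
Let fsadd := lin_c 1.
Let fsscale c f := lin_c c f fs0.
Let fsopp := fsscale (-1).

Let fsaddA : associative fsadd.
Proof. by move=> f g h; apply/val_inj/funext => t /=; rewrite !mul1r addrA. Qed.
Let fsaddC : commutative fsadd.
Proof. by move=> f g; apply/val_inj/funext => t /=; rewrite !mul1r addrC. Qed.
Let fsadd0 : left_id fs0 fsadd.
Proof. by move=> f; apply/val_inj/funext => t /=; rewrite mul1r add0r. Qed.
Let fsaddN : left_inverse fs0 fsopp fsadd.
Proof.
by move=> f; apply/val_inj/funext => t /=; rewrite mul1r addr0 mulN1r addNr.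
Qed.
HB.instance Definition _ := GRing.isZmodule.Build finsupp fsaddA fsaddC fsadd0 fsaddN.

Let fsscaleA c d f : fsscale c (fsscale d f) = fsscale (c * d) f.
Proof. by apply/val_inj/funext => t /=; rewrite !addr0 mulrA. Qed.
Let fsscale1 : left_id 1 fsscale.
Proof. by move=> f; apply/val_inj/funext => t /=; rewrite mul1r addr0. Qed.
Let fsscaleDr : right_distributive fsscale +%R.
Proof.
by move=> c f g; apply/val_inj/funext => t /=; rewrite !mul1r !addr0 mulrDr.
Qed.
Let fsscaleDl f : {morph fsscale^~ f : c d / c + d}.
Proof.
by move=> c d; apply/val_inj/funext => t /=; rewrite !mul1r !addr0 mulrDl.
Qed.
HB.instance Definition _ := GRing.Zmodule_isLmodule.Build C finsupp
  fsscaleA fsscale1 fsscaleDr fsscaleDl.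

Lemma finsupp_linE (c : C) (f g : finsupp) t :
  val (c *: f + g) t = c * val f t + val g t.
Proof. by rewrite /= mul1r addr0. Qed.

Definition dot (f g : finsupp) : C := \sum_(t \in [set: G]) val f t * (val g t)^*.

Lemma dotE f g (D : set G) : finite_set D -> [set t | val f t != 0] `<=` D ->
  dot f g = \sum_(t <- fset_set D) val f t * (val g t)^*.
Proof.
move=> Df fD; rewrite /dot -(fsbig_widen D) ?fsbig_finite //.
move=> t [_ /= Dt]; apply/eqP; rewrite mulf_eq0.
by apply/orP; left; apply: contra_notT Dt => /fD.
Qed.

Lemma dot_semi_inner_product : semi_inner_product dot.
Proof.
split=> [c f g h|f g|f].
- pose D := [set t | val f t != 0] `|` [set t | val g t != 0].
  have Df : finite_set D by rewrite finite_setU; split; exact: finsuppP.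
  have fgD : [set t | val (c *: f + g) t != 0] `<=` D.
    move=> t; apply: contraPP => /not_orP[/negP/negPn/eqP f0 /negP/negPn/eqP g0].
    by apply/negP/negPn; rewrite finsupp_linE f0 g0 mulr0 addr0.
  have fD : [set t | val f t != 0] `<=` D by left.
  have gD : [set t | val g t != 0] `<=` D by right.
  rewrite (dotE _ Df fgD) (dotE _ Df fD) (dotE _ Df gD).
  rewrite mulr_sumr -big_split /=; apply: eq_bigr => t _.
  by rewrite mul1r addr0 mulrDl mulrA.
- pose D := [set t | val f t != 0] `|` [set t | val g t != 0].
  have Df : finite_set D by rewrite finite_setU; split; exact: finsuppP.
  rewrite (@dotE _ _ D) //; last by move=> t; right.
  rewrite (@dotE _ _ D) //; last by move=> t; left.
  rewrite rmorph_sum; apply: eq_bigr => t _.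
  by rewrite rmorphM /= conjCK mulrC.
- by apply: fsumr_ge0 => t _; exact: mul_conjC_ge0.
Qed.

Definition delta (s : G) : G -> C := fun t => (t == s)%:R.

Lemma finite_supp_delta s : finite_set [set t | delta s t != 0].
Proof.
apply: (@sub_finite_set _ _ [set s]) => // t /=; rewrite /delta.
by case: (t =P s) => // _; rewrite eqxx.
Qed.

Lemma dot_val f t : dot f f = 0 -> val f t = 0.
Proof.
pose D := [set t | val f t != 0] `|` [set t].
have Df : finite_set D by rewrite finite_setU; split; [exact: finsuppP|].
rewrite (@dotE _ _ D) //; last by move=> s; left.
move=> /eqP; rewrite psumr_eq0; last by move=> s _; exact: mul_conjC_ge0.
have tD : t \in fset_set D by rewrite in_fset_set //; apply: mem_set; right.
by move=> /allP/(_ t tD); rewrite mul_conjC_eq0 => /eqP.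
Qed.

Section SignedPermutation.
Variables (chi : G -> bool) (s r : G -> G).
Hypotheses (sK : cancel s r) (rK : cancel r s).

Lemma finite_supp_signed_perm (f : finsupp) :
  finite_set [set t | (-1) ^+ chi t * val f (s t) != 0].
Proof.
apply: (@sub_finite_set _ _ (r @` [set t | val f t != 0])).
  move=> t /=; rewrite mulf_eq0 negb_or => /andP[_ h].
  by exists (s t) => //; rewrite sK.
exact/finite_image/finsuppP.
Qed.

Definition signed_perm (f : finsupp) : finsupp := mkfinsupp (finite_supp_signed_perm f).

Lemma signed_perm_linear : linear signed_perm.
Proof.
move=> c f g; apply/val_inj/funext => t /=.
by rewrite !mul1r !addr0 mulrDr mulrCA.
Qed.

Lemma vnorm_signed_perm f : vnorm dot (signed_perm f) = vnorm dot f.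
Proof.
congr (Num.sqrt (complex.Re _)); rewrite /dot [RHS](reindex_fsbigT s) /=; last by exists r.
apply: eq_fsbigr => t _; rewrite rmorphM /= rmorph_sign mulrACA -signr_addb.
by rewrite addbb mul1r.
Qed.

End SignedPermutation.

Lemma signed_perm_adjoint chi s r (sK : cancel s r) (rK : cancel r s) :
  adjoint_pair dot (signed_perm chi sK, signed_perm (chi \o r) rK).
Proof.
split=> /=; [exact: signed_perm_linear|exact: signed_perm_linear| | |].
- move=> f g; rewrite /dot (reindex_fsbigT r) /=; last by exists s.
  apply: eq_fsbigr => t _; rewrite rK rmorphM /= rmorph_sign.
  by rewrite mulrCA mulrA.
- by exists 1 => // f; rewrite vnorm_signed_perm // mul1r.
- by exists 1 => // f; rewrite vnorm_signed_perm // mul1r.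
Qed.

(** [M chi s r] stands for the operator [f |-> (t |-> (-1)^(chi t) f (s t))] on
    finitely supported functions, [r] being the inverse of [s].  The last clause
    follows by evaluating at a delta function. *)
Theorem cstar_of_signed_perms (g0 : G) : exists (B : cstarType R)
    (M : (G -> bool) -> (G -> G) -> (G -> G) -> B),
  [/\ forall chi s r chi' s' r',
        cancel s r -> cancel r s -> cancel s' r' -> cancel r' s' ->
        M chi s r * M chi' s' r' =
        M (fun t => chi t (+) chi' (s t)) (s' \o s) (r \o r'),
      forall b, M (fun=> b) id id = (-1) ^+ b,
      forall chi s r, cancel s r -> cancel r s ->
        star (M chi s r) = M (chi \o r) r s
    & forall (c : C) chi s r chi' s' r',
        cancel s r -> cancel r s -> cancel s' r' -> cancel r' s' ->
        M chi s r = c *: M chi' s' r' -> s =1 s'].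
Proof.
have hE := dot_semi_inner_product.
pose e0 := mkfinsupp (finite_supp_delta g0).
have he : dot e0 e0 != 0.
  by apply/eqP => /(dot_val g0)/eqP; rewrite /= /delta eqxx oner_eq0.
have [B [L [LM [L1 LN1] Ls LZ]]] := cstar_of_operators hE he.
pose U (chi : G -> bool) s : finsupp -> finsupp := fun f =>
  insubd (0 : finsupp) (fun t => (-1) ^+ chi t * val f (s t)).
have UE chi s r (sK : cancel s r) (rK : cancel r s) : U chi s = signed_perm chi sK.
  apply/funext => f; apply: val_inj; rewrite val_insubd.
  case: ifP => // /negP[]; apply/asboolP; exact: finite_supp_signed_perm sK f.
have Uadj chi s r : cancel s r -> cancel r s ->
    adjoint_pair dot (U chi s, U (chi \o r) r).
  by move=> sK rK; rewrite (UE _ _ _ sK rK) (UE _ _ _ rK sK); exact: signed_perm_adjoint.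
exists B, (fun chi s r => L (U chi s, U (chi \o r) r)).
split=> [chi s r chi' s' r' sK rK sK' rK'||chi s r sK rK|].
- rewrite LM; [|exact: Uadj|exact: Uadj]; congr (L (_, _)).
    have ssK : cancel (s' \o s) (r \o r') by exact: can_comp.
    have rrK : cancel (r \o r') (s' \o s) by exact: can_comp.
    rewrite (UE _ _ _ sK rK) (UE _ _ _ sK' rK') (UE _ _ _ ssK rrK).
    apply/funext => f; apply/val_inj/funext => t /=.
    by rewrite signr_addb mulrA.
  have ssK : cancel (s' \o s) (r \o r') by exact: can_comp.
  have rrK : cancel (r \o r') (s' \o s) by exact: can_comp.
  rewrite (UE _ _ _ rK sK) (UE _ _ _ rK' sK') (UE _ _ _ rrK ssK).
  apply/funext => f; apply/val_inj/funext => t /=.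
  by rewrite signr_addb rK mulrA mulrAC mulrC mulrA.
- move=> b; rewrite (_ : _ \o _ = (fun=> b)) //.
  have -> : U (fun=> b) id = if b then -%R else id.
    rewrite (UE _ id id (fun=> erefl) (fun=> erefl)).
    by apply/funext => f; apply/val_inj/funext => t; case: (b);
      rewrite /= ?addr0 ?mul1r.
  by case: b.
- rewrite Ls; last exact: Uadj.
  congr (L (_, U _ _)); by apply/funext => t; rewrite /= sK.
move=> c chi s r chi' s' r' sK rK sK' rK' e t.
pose f := mkfinsupp (finite_supp_delta (s t)).
have := LZ _ _ _ _ _ (Uadj chi _ _ sK rK) (Uadj chi' _ _ sK' rK') e f.
move=> v0; have : dot (U chi s f - c *: U chi' s' f) (U chi s f - c *: U chi' s' f) = 0.
  apply/eqP; rewrite eq_complex -[complex.Re _]/(re_ip dot _ _) -(vnorm_sq hE).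
  rewrite v0 expr0n eqxx /=.
  by have := ip_ge0 hE (U chi s f - c *: U chi' s' f); rewrite lecE => /andP[].
move=> /(dot_val t); rewrite (UE _ _ _ sK rK) (UE _ _ _ sK' rK').
rewrite addrC -scaleNr finsupp_linE /= /delta eqxx mulr1.
case: (s' t =P s t) => [->//|_] /eqP.
by rewrite mulr0 mulr0 add0r signr_eq0.
Qed.

End FiniteSupport.

(** * The signature of a partition, as a parity of inversions *)

Section Inversions.
Local Open Scope nat_scope.
Variable N : nat.
Implicit Types (s u v w : seq 'I_N) (x y : 'I_N).

Fixpoint inversions s : nat :=
  if s is x :: s' then count (fun y : 'I_N => y < x) s' + inversions s' else 0.

Lemma inversions_cat s u : inversions (s ++ u) =
  inversions s + inversions u + \sum_(x <- s) count (fun y : 'I_N => y < x) u.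
Proof.
elim: s => [|x s IH] /=; first by rewrite big_nil addn0.
by rewrite IH count_cat big_cons; lia.
Qed.

(** A pair of distinct letters is inverted either in [v] or in [rev v]. *)
Lemma inversions_rev v :
  inversions v + inversions (rev v) = \sum_(x <- v) count (fun y : 'I_N => y < x) v.
Proof.
elim: v => [|x v IH]; first by rewrite big_nil.
rewrite rev_cons -cats1 inversions_cat big_cons /= ltnn.
have -> : \sum_(y <- rev v) count (fun z : 'I_N => z < y) [:: x] =
    \sum_(y <- v) (x < y).
  by rewrite (perm_big v) ?perm_rev //=; apply: eq_bigr => y _; rewrite addn0.
have -> : \sum_(y <- v) ((x < y) + count (fun z : 'I_N => z < y) v) =
    \sum_(y <- v) (x < y) + \sum_(y <- v) count (fun z : 'I_N => z < y) v.
  by rewrite -big_split.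
by rewrite -IH; lia.
Qed.

Lemma odd_inversions_cat_rev u v : perm_eq u v ->
  odd (inversions (u ++ rev v)) = odd (inversions u + inversions v).
Proof.
move=> uv; rewrite inversions_cat.
under eq_bigr do rewrite count_rev.
by rewrite (perm_big v) //= -inversions_rev; lia.
Qed.

Lemma even_sum_word u (F : 'I_N -> nat) : (forall x, ~~ odd (count_mem x u)) ->
  ~~ odd (\sum_(y <- u) F y).
Proof.
have -> : \sum_(y <- u) F y = \sum_z count_mem z u * F z.
  elim: u => [|y u IH]; first by rewrite big_nil big1.
  have Fy : F y = \sum_z (y == z) * F z.
    rewrite (bigD1 y) // eqxx mul1n big1 /= ?addn0 // => z zy.
    by rewrite eq_sym (negPf zy).
  by rewrite big_cons IH Fy -big_split; apply: eq_bigr => z _ /=; rewrite mulnDl.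
move=> ev; elim/big_ind: _ => // [a b|z _].
  by rewrite oddD => /negPf-> /negPf->.
by rewrite oddM (negPf (ev z)).
Qed.

Lemma even_count_word u (p : pred 'I_N) : (forall x, ~~ odd (count_mem x u)) ->
  ~~ odd (count p u).
Proof. by move=> ev; rewrite -sum1_count big_mkcond; exact: even_sum_word. Qed.

(** This is the noncrossing condition for the partition of the positions of [w]
    into the classes of equal letters. *)
Definition noncrossing_word w := forall x y, subseq [:: x; y; x; y] w -> x = y.

(** Let [x] be the first letter and write [w = x u x v] with [x] not in [u].  By
    the noncrossing condition no letter of [u] occurs in [v], so [u] and [v]
    inherit the hypotheses; the inversions between [u] and the rest come in even
    number because [u] has even multiplicities, and those of the two [x] with
    [v] occur twice. *)
Lemma even_noncrossing_word w : (forall x, ~~ odd (count_mem x w)) ->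
  noncrossing_word w -> ~~ odd (inversions w).
Proof.
have [n] := ubnP (size w); elim: n w => // n IH [//|x w] /ltnSE sw ev nc.
have xw : x \in w.
  by move: (ev x); rewrite /= eqxx -has_pred1 has_count; case: (count _ w).
set u := take (index x w) w; set v := drop (index x w).+1 w.
have ew : w = u ++ x :: v by rewrite -drop_index // cat_take_drop.
have xu : x \notin u by rewrite in_take // ltnn.
move: u v ew xu => u v ew xu; rewrite {xw}ew in sw ev nc *.
rewrite /= size_cat /= in sw.
have yv y : y \in u -> y \notin v.
  move=> yu; apply/negP => yv; suff : x = y by move=> e; rewrite e yu in xu.
  apply: nc; rewrite -cat_cons; apply: (@cat_subseq _ [:: x; y] [:: x; y]).
    by rewrite /= eqxx sub1seq.
  by rewrite /= eqxx sub1seq.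
have evu y : ~~ odd (count_mem y u).
  have [yu|/count_memPn->//] := boolP (y \in u).
  have xy : (x == y) = false by apply/negP => /eqP e; rewrite e yu in xu.
  by have := ev y; rewrite /= count_cat /= (count_memPn (yv _ yu)) xy; lia.
have evv y : ~~ odd (count_mem y v).
  have [yu|/count_memPn yu] := boolP (y \in u).
    by rewrite (count_memPn (yv _ yu)).
  by have := ev y; rewrite /= count_cat yu /=; lia.
have subu : subseq u (x :: u ++ x :: v).
  exact: subseq_trans (prefix_subseq _ _) (subseq_cons _ _).
have subv : subseq v (x :: u ++ x :: v).
  rewrite -cat_cons; apply: subseq_trans (suffix_subseq _ _).
  exact: subseq_cons.
have iu : ~~ odd (inversions u).
  apply: IH => //; first by lia.
  by move=> a b ab; apply: nc; exact: subseq_trans ab subu.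
have iv : ~~ odd (inversions v).
  apply: IH => //; first by lia.
  by move=> a b ab; apply: nc; exact: subseq_trans ab subv.
rewrite -cat_cons inversions_cat big_cons /= ltnn add0n.
have := even_sum_word (fun y => count (fun z : 'I_N => z < y) (x :: v)) evu.
have := even_count_word (fun y : 'I_N => y < x) evu.
move: (count _ u) (count _ v) (bigop _ _ _) iu iv => a b c; lia.
Qed.

End Inversions.

Section LegLabels.
Local Open Scope nat_scope.
Variables N k l : nat.
Implicit Types (f : leg k l -> 'I_N) (p q : leg k l).

(** Partitions are handled through a labelling of the legs, because a switch
    amounts to composing the labelling with a transposition. *)
Definition blocks f : {set {set leg k l}} := preim_partition f finset.setT.

Lemma mem_blocks f (B : {set leg k l}) :
  reflect (exists p, B = [set q | f p == f q]%SET) (B \in blocks f).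
Proof.
apply: (iffP imsetP) => [[p _ ->]|[p ->]]; exists p => //;
  by apply/setP => q; rewrite !inE.
Qed.

Lemma blocks_tperm f p q :
  [set tperm p q @: B | B : {set leg k l} in blocks f]%SET = blocks (f \o tperm p q).
Proof.
have img r : (tperm p q @: [set x | f r == f x] =
    [set x | (f \o tperm p q) (tperm p q r) == (f \o tperm p q) x])%SET.
  apply/setP => x; apply/imsetP/idP => [[y]|].
    by rewrite !inE => h ->; rewrite /= !tpermK.
  by rewrite inE /= tpermK => h; exists (tperm p q x); rewrite ?inE ?tpermK.
apply/setP => B; apply/imsetP/mem_blocks => [[C /mem_blocks[r ->] ->]|[r ->]].
  by exists (tperm p q r); rewrite img.
exists [set x | f (tperm p q r) == f x]%SET; last by rewrite img // tpermK.
by apply/mem_blocks; exists (tperm p q r).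
Qed.

Lemma pblock_blocks f p : finset.pblock (blocks f) p = [set q | f p == f q]%SET.
Proof.
have /and3P[_ tI _] := preim_partitionP f [set: leg k l]%SET.
by apply: def_pblock => //; [apply/mem_blocks; exists p|rewrite inE].
Qed.

Lemma pblock_blocks_eq f p q :
  (finset.pblock (blocks f) p == finset.pblock (blocks f) q) = (f p == f q).
Proof.
rewrite !pblock_blocks; apply/eqP/eqP => [/setP/(_ q)|->//].
by rewrite !inE eqxx => /eqP.
Qed.

Definition upper f := [seq f (inl a) | a <- enum 'I_k].
Definition lower f := [seq f (inr b) | b <- enum 'I_l].
Definition row_inversions f := inversions (upper f) + inversions (lower f).

Lemma enum_ord_neighbors n (a b : 'I_n) : b = a.+1 :> nat ->
  exists e1 e2, [/\ enum 'I_n = e1 ++ [:: a, b & e2],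
    a \notin e1 ++ e2 & b \notin e1 ++ e2].
Proof.
move=> ab; exists (take a (enum 'I_n)), (drop a.+2 (enum 'I_n)).
have sz : size (enum 'I_n) = n by rewrite size_enum_ord.
have e : enum 'I_n = take a (enum 'I_n) ++ [:: a, b & drop a.+2 (enum 'I_n)].
  rewrite -{1}(cat_take_drop a (enum 'I_n)); congr (_ ++ _).
  rewrite (drop_nth a) ?sz // nth_ord_enum; congr (_ :: _).
  by rewrite (drop_nth a) ?sz -?ab // nth_ord_enum.
have : uniq ([:: a; b] ++ take a (enum 'I_n) ++ drop a.+2 (enum 'I_n)).
  by rewrite uniq_catCA /= -e enum_uniq.
by rewrite /= inE negb_or => /and3P[/andP[_ ->] -> _].
Qed.

Lemma inversions_swap (s1 s2 : seq 'I_N) (x y : 'I_N) :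
  inversions (s1 ++ [:: x, y & s2]) + (x < y) =
  inversions (s1 ++ [:: y, x & s2]) + (y < x).
Proof.
rewrite !inversions_cat.
have -> : \sum_(z <- s1) count (fun y : 'I_N => y < z) [:: x, y & s2] =
    \sum_(z <- s1) count (fun y : 'I_N => y < z) [:: y, x & s2].
  by apply: eq_bigr => z _ /=; rewrite addnCA.
by rewrite /=; lia.
Qed.

Lemma row_swap (T : eqType) (F : T -> 'I_N) (e1 e2 : seq T) a b (t : T -> T) :
  a \notin e1 ++ e2 -> b \notin e1 ++ e2 -> t a = b -> t b = a ->
  (forall c, c != a -> c != b -> t c = c) ->
  [seq F (t c) | c <- e1 ++ [:: a, b & e2]] =
  [seq F c | c <- e1] ++ [:: F b, F a & [seq F c | c <- e2]].
Proof.
rewrite !mem_cat !negb_or => /andP[a1 a2] /andP[b1 b2] ta tb tc.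
rewrite map_cat /= ta tb; congr (_ ++ [:: _, _ & _]); apply/eq_in_map => c ce;
  by rewrite tc //; apply/eqP => e; move: ce; rewrite e; apply/negP.
Qed.

Lemma row_tperm (T : finType) (f : T -> 'I_N) n (h : 'I_n -> T) (a b : 'I_n) :
  injective h -> b = a.+1 :> nat ->
  let row g := [seq g (h c) | c <- enum 'I_n] in
  inversions (row (f \o tperm (h a) (h b))) + (f (h b) < f (h a)) =
    inversions (row f) + (f (h a) < f (h b)) /\
  perm_eq (row (f \o tperm (h a) (h b))) (row f).
Proof.
move=> hi ab row; have [e1 [e2 [e ha hb]]] := enum_ord_neighbors ab.
have eu : row f = [seq f (h c) | c <- e1] ++
    [:: f (h a), f (h b) & [seq f (h c) | c <- e2]] by rewrite /row e map_cat.
have -> : row (f \o tperm (h a) (h b)) = [seq f (h c) | c <- e1] ++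
    [:: f (h b), f (h a) & [seq f (h c) | c <- e2]].
  rewrite -(@row_swap _ (fun c => f (h c)) e1 e2 a b (tperm a b)) //.
  - by rewrite /row e; apply: eq_map => c /=; rewrite (inj_tperm _ _ _ hi).
  - by rewrite tpermL.
  - by rewrite tpermR.
  - by move=> c ca cb; rewrite tpermD // eq_sym.
rewrite eu; split; last by rewrite perm_cat2l (perm_catCA [:: _] [:: _]).
by have := inversions_swap [seq f (h c) | c <- e1] [seq f (h c) | c <- e2]
  (f (h a)) (f (h b)); lia.
Qed.

Lemma neighbors_swap f p q : neighbors p q ->
  [/\ row_inversions (f \o tperm p q) + (f q < f p) = row_inversions f + (f p < f q),
      perm_eq (upper (f \o tperm p q)) (upper f)
    & perm_eq (lower (f \o tperm p q)) (lower f)].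
Proof.
case: p => a; case: q => b //= /eqP ab.
  have el : lower (f \o tperm (inl a) (inl b)) = lower f.
    by apply: eq_map => c /=; rewrite tpermD.
  have inl_inj : injective (@inl 'I_k 'I_l) by move=> ? ? [].
  have [e pe] := row_tperm f inl_inj ab; rewrite /row_inversions el; split=> //.
  by rewrite addnAC [X in X + _ = _]e addnAC.
have eu : upper (f \o tperm (inr a) (inr b)) = upper f.
  by apply: eq_map => c /=; rewrite tpermD.
have inr_inj : injective (@inr 'I_k 'I_l) by move=> ? ? [].
have [e pe] := row_tperm f inr_inj ab; rewrite /row_inversions eu; split=> //.
by rewrite -!addnA; congr (_ + _); exact: e.
Qed.

Lemma switch_blocks f p q : neighbors p q -> f p != f q ->
  switch (blocks f) (blocks (f \o tperm p q)).
Proof.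
move=> pq fpq; apply/existsP; exists p; apply/existsP; exists q.
by rewrite pq pblock_blocks_eq fpq blocks_tperm eqxx.
Qed.

Lemma switch_blocksP f P : switch (blocks f) P -> exists p q,
  [/\ neighbors p q, f p != f q & P = blocks (f \o tperm p q)].
Proof.
move=> /existsP[p /existsP[q /and3P[pq]]].
by rewrite pblock_blocks_eq => fpq /eqP->; exists p, q; rewrite blocks_tperm.
Qed.

Lemma upper_monotone f : (forall p q, neighbors p q -> f p <= f q) ->
  forall a b : 'I_k, a <= b -> f (inl a) <= f (inl b).
Proof.
move=> mono a b; elim: {b}(nat_of_ord b) {-2}b (erefl (nat_of_ord b)) => [|n IH] b eb.
  by rewrite eb leqn0 => /eqP a0; rewrite (_ : a = b) //; apply: val_inj; rewrite /= a0.
rewrite leq_eqVlt => /orP[/eqP ab|]; first by rewrite (_ : a = b) //; apply: val_inj.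
rewrite eb ltnS => an; have nk : n < k by have := ltn_ord b; lia.
apply: leq_trans (IH (Ordinal nk) erefl an) _.
by apply: mono; rewrite /= eb.
Qed.

Lemma lower_monotone f : (forall p q, neighbors p q -> f p <= f q) ->
  forall a b : 'I_l, a <= b -> f (inr a) <= f (inr b).
Proof.
move=> mono a b; elim: {b}(nat_of_ord b) {-2}b (erefl (nat_of_ord b)) => [|n IH] b eb.
  by rewrite eb leqn0 => /eqP a0; rewrite (_ : a = b) //; apply: val_inj; rewrite /= a0.
rewrite leq_eqVlt => /orP[/eqP ab|]; first by rewrite (_ : a = b) //; apply: val_inj.
rewrite eb ltnS => an; have nl : n < l by have := ltn_ord b; lia.
apply: leq_trans (IH (Ordinal nl) erefl an) _.
by apply: mono; rewrite /= eb.
Qed.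

(** When both rows are sorted, the labels read along the boundary first increase
    and then decrease, so no pattern [x y x y] occurs. *)
Lemma noncrossing_monotone f : (forall p q, neighbors p q -> f p <= f q) ->
  noncrossing (blocks f).
Proof.
move=> mono; have up := upper_monotone mono; have lo := lower_monotone mono.
apply/forallP => B; apply/implyP => /mem_blocks[p ->].
apply/forallP => C; apply/implyP => /mem_blocks[q ->]; apply/implyP => pq.
have {pq} fpq : f p != f q by apply: contraNneq pq => ->.
apply/negP => /existsP[a /andP[+ /existsP[b /andP[+ /existsP[c /andP[+ /existsP[d]]]]]]].
rewrite !inE => /eqP pa /eqP qb /eqP pc /and4P[/eqP qd].
move: fpq; rewrite pa qb => /eqP fab; have {pa pc} ac : f a = f c by rewrite -pa.
have {qb qd} bd : f b = f d by rewrite -qb.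
have incr (x y : leg k l) : leg_pos x < leg_pos y ->
    match x, y with
    | inl _, inl _ => f x <= f y
    | inr _, inr _ => f y <= f x
    | inl _, inr _ => true
    | inr _, inl _ => false
    end.
  case: x y => [x|x] [y|y] //= h; [exact/up/ltnW| |apply: lo];
    by have := ltn_ord x; have := ltn_ord y; lia.
move=> /incr + /incr + /incr.
have acn : f a = f c :> nat by rewrite ac.
have bdn : f b = f d :> nat by rewrite bd.
move=> h1 h2 h3; apply: fab; apply/val_inj => /=; move: acn bdn h1 h2 h3.
by case: a b c d {ac bd} => [a|a] [b|b] [c|c] [d|d] //=; lia.
Qed.

(** Bubble sort of the two rows. *)
Lemma noncrossing_after_exists f : exists c, noncrossing_after (blocks f) c.
Proof.
have [n] := ubnP (row_inversions f); elim: n f => // n IH f /ltnSE fn.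
have [/existsP[p /existsP[q /andP[pq fpq]]]|] :=
    boolP [exists p, exists q, neighbors p q && (f q < f p)].
  have [e _ _] := neighbors_swap f pq.
  have [|c [s [Ps sc ns]]] := IH (f \o tperm p q); first by lia.
  exists c.+1, (blocks (f \o tperm p q) :: s); split=> //=; last by rewrite sc.
  rewrite Ps andbT switch_blocks //; apply: contraTneq fpq => ->.
  by rewrite ltnn.
move=> /existsPn h; exists 0, [::]; split=> //=.
apply: noncrossing_monotone => p q pq.
by have /existsPn/(_ q) := h p; rewrite pq -leqNgt.
Qed.

(** The legs in the order of [leg_pos], which is why the lower row is
    reversed. *)
Definition boundary : seq (leg k l) :=
  [seq inl a | a <- enum 'I_k] ++ rev [seq inr b | b <- enum 'I_l].

Lemma map_boundary f : map f boundary = upper f ++ rev (lower f).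
Proof. by rewrite /boundary map_cat map_rev -!(map_comp f). Qed.

Lemma sorted_boundary : sorted (fun p q => leg_pos p < leg_pos q) boundary.
Proof.
suff : map (@leg_pos k l) boundary = iota 0 (k + l).
  by move=> e; have := iota_ltn_sorted 0 (k + l); rewrite -e sorted_map.
rewrite /boundary map_cat map_rev -!(map_comp (@leg_pos k l)) iotaD; congr (_ ++ _).
  by rewrite -[RHS]val_enum_ord; apply: eq_map.
have -> : [seq (@leg_pos k l \o inr) b | b <- enum 'I_l] =
    [seq k + (l - b.+1) | b <- iota 0 l].
  by rewrite -val_enum_ord -(map_comp (fun b => k + (l - b.+1))).
apply: (@eq_from_nth _ 0) => [|n]; rewrite size_rev size_map !size_iota // => nl.
rewrite nth_rev ?size_map ?size_iota // (nth_map 0) ?size_iota; last by lia.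
by rewrite !nth_iota //; lia.
Qed.

Lemma noncrossing_boundary_word f : noncrossing (blocks f) ->
  noncrossing_word (upper f ++ rev (lower f)).
Proof.
move=> nc x y; rewrite -map_boundary => /subseqP[m _].
rewrite -map_mask => e.
have : sorted (fun p q => leg_pos p < leg_pos q) (mask m boundary).
  apply: sorted_mask sorted_boundary.
  by move=> ? ? ?; exact: ltn_trans.
case: (mask m boundary) e => [|a [|b [|c [|d []]]]] //= [xa yb xc yd].
move=> /and4P[ab bc cd _]; apply/eqP; apply: contraT => xy.
have hB : [set p | f a == f p]%SET \in blocks f by apply/mem_blocks; exists a.
have hC : [set p | f b == f p]%SET \in blocks f by apply/mem_blocks; exists b.
have BC : [set p | f a == f p]%SET != [set p | f b == f p]%SET.
  apply/eqP => /setP/(_ b); rewrite !inE eqxx -xa -yb => /eqP e.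
  by rewrite e eqxx in xy.
have /forallP/(_ _)/implyP/(_ hB)/forallP/(_ _)/implyP/(_ hC)/implyP/(_ BC)/negP := nc.
case.
apply/existsP; exists a; rewrite inE eqxx; apply/existsP; exists b.
rewrite inE eqxx; apply/existsP; exists c; rewrite inE -xc xa eqxx.
by apply/existsP; exists d; rewrite inE -yd yb eqxx ab bc cd.
Qed.

(** Each switch changes the number of inversions by one, and at the end it is
    even by [even_noncrossing_word], applied to the boundary word. *)
Lemma odd_noncrossing_after f c : perm_eq (upper f) (lower f) ->
  noncrossing_after (blocks f) c -> odd c = odd (row_inversions f).
Proof.
move=> ul [s [Ps <- ns]] {c}; elim: s f ul Ps ns => [|P s IH] f ul /=.
  move=> _ /noncrossing_boundary_word/even_noncrossing_word h.
  rewrite /row_inversions -odd_inversions_cat_rev //; apply/esym/negbTE/h => x.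
  by rewrite count_cat count_rev (seq.permP ul) addnn odd_double.
case/andP => /switch_blocksP[p [q [pq fpq ->]]] Ps ns.
have [e pu pl] := neighbors_swap f pq.
rewrite (IH (f \o tperm p q)) //; last first.
  by rewrite (perm_trans pu) // (perm_trans ul) // perm_sym.
have : (f p < f q) (+) (f q < f p) by move: fpq; rewrite -val_eqE /=; lia.
lia.
Qed.



End LegLabels.

Section Kernels.
Local Open Scope nat_scope.
Variables N k : nat.
Implicit Types (i j : k.-tuple 'I_N).

Definition index_label i j (p : leg k k) : 'I_N :=
  match p with inl a => tnth i a | inr b => tnth j b end.

Lemma kernelE i j : Defs.kernel i j = blocks (index_label i j).
Proof. by []. Qed.

Lemma upper_index_label i j : upper (index_label i j) = i.
Proof. exact: map_tnth_enum. Qed.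

Lemma lower_index_label i j : lower (index_label i j) = j.
Proof. exact: map_tnth_enum. Qed.

Lemma card_tnth_eq i x : #|[set a | x == tnth i a]%SET| = count_mem x i.
Proof.
rewrite cardsE cardE -[in RHS](map_tnth_enum i) count_map -size_filter.
congr size; rewrite enumT {1}/enum_mem; apply: eq_filter => a.
exact: eq_sym.
Qed.

Lemma Pvert_kernel i j : Pvert (Defs.kernel i j) = perm_eq i j.
Proof.
rewrite kernelE /Pvert preim_partitionP /=.
have count_block x : let B := [set q | x == index_label i j q]%SET in
    #|[set a : 'I_k | inl a \in B]%SET| = count_mem x i /\
    #|[set b : 'I_k | inr b \in B]%SET| = count_mem x j.
  by rewrite -!card_tnth_eq; split; apply: eq_card => a; rewrite !inE.
apply/forallP/allP => [h x|h B].
  rewrite mem_cat => xij; have [p ->] : exists p, x = index_label i j p.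
    by case/orP: xij => /tnthP[a ->]; [exists (inl a)|exists (inr a)].
  have /implyP := h [set q | index_label i j p == index_label i j q]%SET.
  have [-> ->] := count_block (index_label i j p); apply.
  by apply/mem_blocks; exists p.
apply/implyP => /mem_blocks[p ->].
have [-> ->] := count_block (index_label i j p); apply: h.
by rewrite mem_cat; case: p => a /=; rewrite mem_tnth ?orbT.
Qed.

Lemma signature_kernel i j : perm_eq i j ->
  signature (Defs.kernel i j) = ((-1) ^+ (inversions i + inversions j))%R.
Proof.
move=> ij; rewrite kernelE; have hc := noncrossing_after_exists (index_label i j).
have /odd_noncrossing_after := xgetPex 0 hc.
rewrite upper_index_label lower_index_label => /(_ ij) h.
rewrite /signature -signr_odd h signr_odd /row_inversions.
by rewrite upper_index_label lower_index_label.
Qed.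

End Kernels.

(** * Words in the generators *)

Section Words.
Variables (N : nat) (T : Type) (idx : T) (op : Monoid.law idx) (y : 'I_N -> T).
Hypothesis yy : forall a, op (y a) (y a) = idx.
Local Notation W w := (\big[op/idx]_(a <- w) y a).

Let opA a b c : op a (op b c) = op (op a b) c.
Proof. exact: Monoid.mulmA. Qed.

Lemma word_cat_rev w : op (W w) (W (rev w)) = idx.
Proof.
elim: w => [|a w IH]; first by rewrite !big_nil Monoid.mul1m.
rewrite rev_cons -cats1 big_cons big_cat big_seq1 /=.
by rewrite opA -(opA (y a)) IH Monoid.mulm1 yy.
Qed.

(** Words are reduced in the free product by cancelling squares, which is allowed
    in every monoid where the letters have square 1. *)
Lemma word_reduce w : W (foldr (@push N) [::] w) = W w.
Proof.
elim: w => //= a w IH; rewrite big_cons -IH.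
case: (foldr _ _ w) => [|b v] /=; first by rewrite big_seq1 big_nil Monoid.mulm1.
case: eqP => [<-|_]; last by rewrite big_cons.
by rewrite big_cons opA yy Monoid.mul1m.
Qed.

(** Any word with the letters of [w] grouped together would do: it serves as
    a trivial word to which [w] can be compared. *)
Definition sorted_word (w : seq 'I_N) : seq 'I_N :=
  flatten [seq nseq (count_mem a w) a | a <- undup w].

Lemma perm_sorted_word w : perm_eq (sorted_word w) w.
Proof. exact: perm_count_undup. Qed.

Lemma even_sorted_word w : (forall a, ~~ odd (count_mem a w)) ->
  W (sorted_word w) = idx.
Proof.
rewrite /sorted_word => ev; elim: (undup w) => [|a s IH] /=; first by rewrite big_nil.
rewrite big_cat {}IH Monoid.mulm1 -[count_mem a w]odd_double_half (negPf (ev a)) add0n.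
elim: (count_mem a w)./2 => [|n IH]; first by rewrite big_nil.
by rewrite doubleS /= !big_cons IH Monoid.mulm1 yy.
Qed.

End Words.

Section GeneratedGroups.
Variables (N : nat) (G : groupType) (g : 'I_N -> G).
Local Open Scope group_scope.

Definition generated_by_involutions : Prop :=
  exists p : Z2star N -> G, [/\ {morph p : a b / a * b},
    set_surj setT setT p & forall i, p (Z2star_gen i) = g i].

Lemma word_Z2star (w : seq 'I_N) :
  word (\prod_(a <- w) Z2star_gen a) = foldr (@push N) [::] w.
Proof. by elim: w => [|a w IH]; rewrite ?big_nil // big_cons /= -IH. Qed.

Hypothesis hg : generated_by_involutions.

Lemma generator_sq a : g a * g a = 1.
Proof.
have [p [pM _ pg]] := hg; rewrite -pg -pM.
have -> : Z2star_gen a * Z2star_gen a = 1.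
  by apply: val_inj; rewrite /= eqxx.
by apply: (mulgI (p 1)); rewrite -pM !mulg1.
Qed.

Lemma generators_surj t : exists w : seq 'I_N, t = \prod_(a <- w) g a.
Proof.
have [p [pM ps pg]] := hg; have [z _ <-] := ps t I.
exists (word z); have p1 : p 1 = 1 by apply: (mulgI (p 1)); rewrite -pM !mulg1.
have {1}-> : z = \prod_(a <- word z) Z2star_gen a.
  by apply: val_inj; rewrite /= word_Z2star foldr_push_nil // (valP z).
by rewrite (big_morph p pM p1); apply: eq_bigr.
Qed.

Lemma word_inv w : (\prod_(a <- w) g a)^-1 = \prod_(a <- rev w) g a.
Proof.
by apply: (mulgI (\prod_(a <- w) g a)); rewrite mulgV word_cat_rev //; exact: generator_sq.
Qed.

End GeneratedGroups.

(** * Group C*-algebras as quotients of the free sphere *)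

(** Left translations on finitely supported functions on [G]. *)
Lemma regular_representation (R : realType) (G : groupType) :
  exists (B : cstarType R) (u : G -> B), unitary_rep u /\ injective u.
Proof.
have [B [M [MM M1 Ms MZ]]] := cstar_of_signed_perms R (1%g : G).
pose mul (t : G) := fun s : G => (t * s)%g.
have mulK t : cancel (mul t) (mul t^-1%g) by exact: mulKg.
have mulVK t : cancel (mul t^-1%g) (mul t) by exact: mulKVg.
pose u (t : G) : B := M (fun=> false) (mul t^-1%g) (mul t).
exists B, u; split; first split.
- rewrite /u invg1 -[RHS](M1 false); congr (M _ _ _);
    by apply/funext => s; exact: mul1g.
- move=> s t; rewrite /u MM //; congr (M _ _ _); apply/funext => r.
    by rewrite /mul /= invMg mulgA.
  by rewrite /mul /= mulgA.
- by move=> t; rewrite /u Ms // invgK.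
move=> s t e.
have := MZ 1 (fun=> false) _ _ (fun=> false) _ _ (mulVK s) (mulK s) (mulVK t) (mulK t).
rewrite scale1r => /(_ e)/(_ 1%g).
by rewrite /mul !mulg1 => /invg_inj.
Qed.

Section Cubes.
Variables (R : realType) (N : nat) (A : cstarType R) (x : 'I_N -> A).
Hypothesis hx : is_free_sphere x.
Local Notation rtN := (sqrtC N%:R : R[i]).

Lemma free_sphere_rank_gt0 : (0 < N)%N.
Proof.
have [[_ +] _] := hx; case: (N) x => // y; rewrite big_ord0 => /esym/eqP.
by rewrite oner_eq0.
Qed.

Lemma sqrt_rank_neq0 : rtN != 0.
Proof. by rewrite sqrtC_eq0 pnatr_eq0 -lt0n free_sphere_rank_gt0. Qed.

Lemma free_sphere_map (B : cstarType R) (y : 'I_N -> B) :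
  (forall i, star (y i) = y i) -> (forall i, y i * y i = 1) ->
  exists f : A -> B, [/\ star_hom f, forall i, f (x i) = rtN^-1 *: y i
    & forall h : A -> B, star_hom h -> (forall i, h (x i) = rtN^-1 *: y i) -> h = f].
Proof.
move=> sy yy; have [_ /(_ B (fun i => rtN^-1 *: y i))] := hx.
case.
  split=> [i|].
    by rewrite /= starZ sy geC0_conj // invr_ge0 sqrtC_ge0 ler0n.
  under eq_bigr => i _ do
    rewrite expr2 -scalerAl -scalerAr scalerA yy -expr2 exprVn sqrtCK.
  rewrite sumr_const card_ord -scaler_nat scalerA mulfV ?scale1r //.
  by rewrite pnatr_eq0 -lt0n free_sphere_rank_gt0.
move=> f [[hf fx] uf]; exists f; split=> // h hh hx'.
by apply/esym/uf.
Qed.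

Lemma sphere_star i : star (x i) = x i.
Proof. by have [[/(_ i)/esym]] := hx. Qed.

Lemma scale_word (B : algType R[i]) (c : R[i]) (y : 'I_N -> B) (w : seq 'I_N) :
  \prod_(a <- w) (c *: y a) = c ^+ size w *: \prod_(a <- w) y a.
Proof.
elim: w => [|a w IH]; first by rewrite !big_nil expr0 scale1r.
by rewrite !big_cons IH -scalerAl -scalerAr scalerA exprS.
Qed.

Lemma star_hom_word (B B' : cstarType R) (f : B -> B') (y : 'I_N -> B)
    (w : seq 'I_N) : star_hom f ->
  f (\prod_(a <- w) y a) = \prod_(a <- w) f (y a).
Proof. by case=> _ fM f1 _; exact: (big_morph f fM f1). Qed.

Section Criterion.
Variables (G : groupType) (g : 'I_N -> G).
Hypothesis hg : generated_by_involutions g.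
Variable J : set A.
Hypothesis hJ : closed_ideal J.

Hypothesis J_word : forall (B : cstarType R) (f : A -> B), star_hom f ->
  (forall a, J a -> f a = 0) ->
  (forall a, (rtN *: f (x a)) * (rtN *: f (x a)) = 1) /\
  forall w : seq 'I_N, (\prod_(a <- w) g a)%g = 1%g ->
    \prod_(a <- w) (rtN *: f (x a)) = 1.

Hypothesis J_rep : forall (B : cstarType R) (u : G -> B) (f : A -> B),
  unitary_rep u -> star_hom f -> (forall i, f (x i) = rtN^-1 *: u (g i)) ->
  forall a, J a -> f a = 0.

Lemma rep_generator (B : cstarType R) (u : G -> B) : unitary_rep u ->
  (forall i, star (u (g i)) = u (g i)) /\ (forall i, u (g i) * u (g i) = 1).
Proof.
case=> u1 uM us; have gg := generator_sq hg; split=> i; last by rewrite -uM gg.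
by rewrite us; congr u; apply: (mulgI (g i)); rewrite gg mulgV.
Qed.

(** The hypothesis [J_word] says that [J] contains the relations of [G], and
    [J_rep] that it contains nothing else.  The quotient is nonzero by [J_rep]
    applied to the regular representation; in it the element of a word depends
    on its value in [G] only, which defines the unitary representation of [G],
    and [J_rep] lets every other one factor through the quotient. *)
Lemma cube_criterion : is_cube x g J.
Proof.
have J1 : ~ J 1.
  have [B [u [hu _]]] := regular_representation R G.
  have [su uu] := rep_generator hu.
  have [f [hf fx _]] := free_sphere_map su uu.
  move=> /(J_rep hu hf fx)/eqP; rewrite (star_hom1 hf).
  by rewrite (negPf (oner_neq0 B)).
have [B [f [hf fsurj fJ]]] := cstar_ideal_quotient hJ J1.
have [yy yw] := J_word hf (fun a => (fJ a).2).
pose y a := rtN *: f (x a); pose W w : B := \prod_(a <- w) y a.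
have Wcat v w : W (v ++ w) = W v * W w by rewrite /W big_cat.
have WE v w : (\prod_(a <- v) g a = \prod_(a <- w) g a)%g -> W v = W w.
  move=> e; have h : W (v ++ rev w) = 1.
    apply: yw; rewrite big_cat /= e.
    exact: (@word_cat_rev _ _ _ (@mulg G) g (generator_sq hg)).
  have h' : W (rev w) * W w = 1.
    by have := @word_cat_rev _ _ _ (@GRing.mul B) y yy (rev w); rewrite revK.
  by rewrite -[W v]mulr1 -h' mulrA -Wcat h mul1r.
have /choice[word_of hword] := generators_surj hg.
pose u t := W (word_of t).
have uW w : u (\prod_(a <- w) g a)%g = W w by apply: WE; rewrite -hword.
have ug i : u (g i) = y i.
  by have := uW [:: i]; rewrite /W !big_seq1.
have sy a : star (y a) = y a.
  by rewrite starZ -(star_hom_star hf) sphere_star geC0_conj // sqrtC_ge0 ler0n.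
have hu : unitary_rep u.
  split=> [|s t|t].
  - by have := uW [::]; rewrite /W !big_nil.
  - by rewrite [in LHS](hword s) [in LHS](hword t) -big_cat uW Wcat.
  - rewrite [in RHS](hword t) (word_inv hg) uW /u /W.
    elim: (word_of t) => [|a w IH].
      by rewrite !big_nil (seminorm_star1 (@cnorm_seminorm R B)).
    by rewrite rev_cons -cats1 big_cat big_cons starM IH sy /= big_seq1.
have fx i : f (x i) = rtN^-1 *: u (g i).
  by rewrite ug scalerA mulVf ?scale1r // sqrt_rank_neq0.
exists B, u, f; split=> //; last first.
- by apply/seteqP; split=> a /fJ.
- by move=> b _; have [a ->] := fsurj b; exists a.
split=> // B' u' hu'; have [su' uu'] := rep_generator hu'.
have [f' [hf' fx' uf']] := free_sphere_map su' uu'.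
have /choice[lift hlift] := fsurj.
have liftE a : f' (lift (f a)) = f' a.
  apply/eqP; rewrite -subr_eq0 -(star_homB hf'); apply/eqP.
  by apply: (J_rep hu' hf' fx'); apply/fJ; rewrite (star_homB hf) -hlift subrr.
pose h b := f' (lift b).
have hfE a : h (f a) = f' a by exact: liftE.
have hh : star_hom h.
  split=> [c b b'|b b'||b].
  - have [[a ->] [a' ->]] := conj (fsurj b) (fsurj b').
    rewrite -(star_homZ hf) -(star_homD hf) !hfE.
    by rewrite (star_homD hf') (star_homZ hf').
  - have [[a ->] [a' ->]] := conj (fsurj b) (fsurj b').
    by rewrite -(star_homM hf) !hfE (star_homM hf').
  - by rewrite -(star_hom1 hf) hfE (star_hom1 hf').
  - have [a ->] := fsurj b.
    by rewrite -(star_hom_star hf) !hfE (star_hom_star hf').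
exists h; split.
  split=> // t; rewrite [in RHS](hword t) /u /W star_hom_word //.
  have [u1 uM _] := hu'; rewrite (big_morph u' uM u1).
  apply: eq_bigr => a _; rewrite (star_homZ hh) hfE fx' scalerA mulfV ?scale1r //.
  exact: sqrt_rank_neq0.
move=> h' [hh' hu'']; apply/funext => b; rewrite (hlift b) hfE.
have -> : f' = h' \o f; last by [].
apply/esym/uf'; last by move=> i /=; rewrite fx (star_homZ hh') hu''.
have [hl hm h1 hs] := hh'; have [fl fm f1 fs] := hf.
by split=> [c a a'|a a'||a] /=; rewrite ?fl ?fm ?f1 ?fs ?hl ?hm ?hs.
Qed.

End Criterion.

(** By universality, on the group algebra and then on the free sphere, [f]
    factors through the quotient map defining the cube. *)
Lemma cube_ker (G : groupType) (g : 'I_N -> G) (X : set A)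
    (B : cstarType R) (u : G -> B) (f : A -> B) :
  generated_by_involutions g -> is_cube x g X ->
  unitary_rep u -> star_hom f -> (forall i, f (x i) = rtN^-1 *: u (g i)) ->
  forall a, X a -> f a = 0.
Proof.
move=> hg [B' [u' [f' [[hu' U] hf' _ fx' ->]]]] hu hf fx a /= fa0.
have [h [[hh hu''] _]] := U B u hu.
have [su uu] := rep_generator hg hu; have [f0 [_ _ uf]] := free_sphere_map su uu.
have -> : f = h \o f'; last by rewrite /= fa0 (star_hom0 hh).
rewrite (uf _ hf fx); apply/esym/uf.
  have [hl hm h1 hs] := hh; have [fl fm f1 fs] := hf'.
  by split=> [c b b'|b b'||b] /=; rewrite ?fl ?fm ?f1 ?fs ?hl ?hm ?hs.
by move=> i /=; rewrite fx' (star_homZ hh) hu''.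
Qed.

Lemma cube_unique (G : groupType) (g : 'I_N -> G) (X Y : set A) :
  generated_by_involutions g -> is_cube x g X -> is_cube x g Y -> X = Y.
Proof.
move=> hg hX hY.
have [BX [uX [fX [[huX _] hfX _ fxX eX]]]] := hX.
have [BY [uY [fY [[huY _] hfY _ fxY eY]]]] := hY.
apply/seteqP; split=> a ha.
  by rewrite eY /=; exact: (cube_ker hg hX huY hfY fxY ha).
by rewrite eX /=; exact: (cube_ker hg hY huX hfX fxX ha).
Qed.

(** The group embeds in its full C*-algebra because the regular representation is
    faithful. *)
Lemma cube_word_eq (G : groupType) (g : 'I_N -> G) (X : set A) (v w : seq 'I_N) :
  generated_by_involutions g -> is_cube x g X -> size v = size w ->
  X (\prod_(a <- v) x a - \prod_(a <- w) x a) <->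
  (\prod_(a <- v) g a = \prod_(a <- w) g a)%g.
Proof.
move=> hg hX vw.
have prodE (B : cstarType R) (u : G -> B) (f : A -> B) : unitary_rep u ->
    star_hom f -> (forall i, f (x i) = rtN^-1 *: u (g i)) -> forall z : seq 'I_N,
    f (\prod_(a <- z) x a) = rtN^-1 ^+ size z *: u (\prod_(a <- z) g a)%g.
  move=> [u1 uM _] hf fx z; rewrite star_hom_word //.
  by under eq_bigr do rewrite fx; rewrite scale_word (big_morph u uM u1).
split=> [h|e].
  have [B [u [hu ui]]] := regular_representation R G.
  have [su uu] := rep_generator hg hu.
  have [f [hf fx _]] := free_sphere_map su uu.
  have /eqP := cube_ker hg hX hu hf fx h.
  rewrite (star_homB hf) !(prodE _ _ _ hu hf fx) vw -scalerBr scaler_eq0.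
  rewrite expf_eq0 invr_eq0 (negPf sqrt_rank_neq0) andbF /= subr_eq0.
  by move=> /eqP/ui.
have [B [u [f [[hu _] hf _ fx ->]]]] := hX.
by rewrite /= (star_homB hf) !(prodE _ _ _ hu hf fx) vw e subrr.
Qed.

End Cubes.

Lemma prod_tnth (N k : nat) (T : Type) (idx : T) (op : T -> T -> T)
    (y : 'I_N -> T) (i : k.-tuple 'I_N) :
  \big[op/idx]_(a < k) y (tnth i a) = \big[op/idx]_(a <- i) y a.
Proof. by rewrite big_tuple. Qed.

Section Spheres.
Variables (R : realType) (N : nat) (A : cstarType R) (x : 'I_N -> A).
Hypothesis hx : is_free_sphere x.
Local Notation rtN := (sqrtC N%:R : R[i]).

Definition free_cube : set A :=
  zero_locus [set r | exists i, r = x i ^+ 2 - N%:R^-1 *: 1].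

Lemma free_cube_sq (B : cstarType R) (f : A -> B) (J : set A) :
  star_hom f -> (forall a, free_cube a -> J a) -> (forall a, J a -> f a = 0) ->
  forall a, (rtN *: f (x a)) * (rtN *: f (x a)) = 1.
Proof.
move=> hf ZJ fJ a; have /eqP : f (x a ^+ 2 - N%:R^-1 *: 1) = 0.
  by apply/fJ/ZJ; apply: zero_locus_sub; exists a.
rewrite (star_homB hf) (star_homZ hf) (star_hom1 hf) subr_eq0 => /eqP e.
rewrite -scalerAl -scalerAr scalerA -expr2 sqrtCK -(star_homM hf) -expr2 e.
by rewrite scalerA mulfV ?scale1r // pnatr_eq0 -lt0n (free_sphere_rank_gt0 hx).
Qed.

Lemma free_cube_rep (G : groupType) (g : 'I_N -> G) (B : cstarType R)
    (u : G -> B) (f : A -> B) : generated_by_involutions g ->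
  unitary_rep u -> star_hom f -> (forall i, f (x i) = rtN^-1 *: u (g i)) ->
  forall a, free_cube a -> f a = 0.
Proof.
move=> hg hu hf fx; apply: (star_hom_zero_locus hf) => _ [i ->].
have [_ uu] := rep_generator hg hu.
rewrite (star_homB hf) (star_homZ hf) (star_hom1 hf) expr2 (star_homM hf) !fx.
by rewrite -scalerAl -scalerAr scalerA uu -expr2 exprVn sqrtCK subrr.
Qed.

Lemma Z2star_generated : generated_by_involutions (@Z2star_gen N).
Proof. by exists id; split=> // a _; exists a. Qed.

Lemma free_cubeP : is_cube x (@Z2star_gen N) free_cube.
Proof.
apply: (cube_criterion hx Z2star_generated); first exact: zero_locus_closed_ideal.
- move=> B f hf fZ; have yy := free_cube_sq hf (fun a h => h) fZ; split=> // w e.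
  rewrite -(@word_reduce _ _ _ (@GRing.mul B) _ yy) -word_Z2star e.
  by rewrite /= big_nil.
- by move=> B u f hu hf fx; exact: (free_cube_rep Z2star_generated hu hf fx).
Qed.

Lemma related_words (G : groupType) (g : 'I_N -> G) k (i j : k.-tuple 'I_N) :
  related g i j <->
  perm_eq i j /\ (\prod_(a <- i) g a = \prod_(a <- j) g a)%g.
Proof. by rewrite /related Pvert_kernel !big_tuple. Qed.

Lemma sphere_rep (G : groupType) (g : 'I_N -> G) (B : cstarType R)
    (u : G -> B) (f : A -> B) :
  unitary_rep u -> star_hom f -> (forall i, f (x i) = rtN^-1 *: u (g i)) ->
  forall a, sphere x g a -> f a = 0.
Proof.
move=> [u1 uM _] hf fx; apply: (star_hom_zero_locus hf).
move=> _ [k [i [j [/related_words[_ e] ->]]]].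
rewrite !prod_tnth (star_homB hf) !(star_hom_word _ _ hf).
under eq_bigr do rewrite fx; under [X in _ - X]eq_bigr do rewrite fx.
rewrite !scale_word !size_tuple -!(big_morph u uM u1) e.
exact: subrr.
Qed.

(** The coordinate [a] of the image of a word in [Z_2^N] counts the letter [a]
    modulo 2. *)
Lemma even_word (G : groupType) (g : 'I_N -> G) : reflection_group g ->
  forall w : seq 'I_N, (\prod_(a <- w) g a = 1)%g -> forall a, ~~ odd (count_mem a w).
Proof.
move=> [_ [q [qM _ qg]]] w e a.
have q1 : q 1%g = 0 by apply: (addrI (q 1%g)); rewrite -qM mulg1 addr0.
have : q (\prod_(a <- w) g a)%g 0 a = 0 by rewrite e q1 mxE.
have -> : q (\prod_(a <- w) g a)%g 0 a = (count_mem a w)%:R.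
  elim: w {e} => [|b w IH]; first by rewrite big_nil q1 mxE.
  by rewrite big_cons qM qg !mxE IH /= natrD [b == a]eq_sym.
by move/eqP; rewrite -(dvdn_pcharf (pchar_Fp (isT : prime 2))) dvdn2.
Qed.

(** A word [w] with [g_w = 1] has even multiplicities, so [w] and
    [sorted_word w] satisfy the condition imposed on pairs of multi-indices, and
    both have value 1 in [G]; on the free cube [sorted_word w] has value 1 too. *)
Lemma cube_of_sphere (G : groupType) (g : 'I_N -> G) : reflection_group g ->
  is_cube x g (intersection (sphere x g) free_cube).
Proof.
move=> hg; have gg : generated_by_involutions g by case: hg.
have hJ := zero_locus_closed_ideal (sphere x g `|` free_cube).
apply: (cube_criterion hx gg hJ) => [B f hf fJ|B u f hu hf fx]; last first.
  apply: (star_hom_zero_locus hf) => a [].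
    exact: (sphere_rep hu hf fx).
  exact: (free_cube_rep gg hu hf fx).
have ZJ a : free_cube a -> intersection (sphere x g) free_cube a.
  by move=> Za; apply: zero_locus_sub; right.
have yy := free_cube_sq hf ZJ fJ; split=> // w gw.
have ev := even_word hg gw.
have sz : size (sorted_word w) == size w by rewrite (perm_size (perm_sorted_word w)).
pose i := in_tuple w; pose j := Tuple sz.
have : f (\prod_(a <- w) x a - \prod_(a <- sorted_word w) x a) = 0.
  apply: fJ; apply: zero_locus_sub; left; apply: zero_locus_sub.
  exists (size w), i, j; rewrite !prod_tnth; split=> //.
  apply/related_words; split; first by rewrite perm_sym perm_sorted_word.
  rewrite /= gw; apply/esym.
  exact: (@even_sorted_word _ _ _ (@mulg G) g (generator_sq gg) _ ev).
rewrite (star_homB hf) !(star_hom_word _ _ hf) => /eqP.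
rewrite subr_eq0 !scale_word => /eqP->; rewrite -(eqP sz) -scale_word.
exact: (@even_sorted_word _ _ _ (@GRing.mul B) _ yy _ ev).
Qed.

(** The defining relations of the sphere, with the equality of words in the group
    expressed through the ideal [X] of the cube. *)
Definition sphere_of (X : set A) : set A :=
  zero_locus [set r | exists k (i j : k.-tuple 'I_N),
    [/\ Pvert (Defs.kernel i j),
        X (\prod_(a < k) x (tnth i a) - \prod_(a < k) x (tnth j a))
      & r = \prod_(a < k) x (tnth i a) - \prod_(a < k) x (tnth j a)]].

Definition twisted_sphere_of (X : set A) : set A :=
  zero_locus [set r | exists k (i j : k.-tuple 'I_N),
    [/\ Pvert (Defs.kernel i j),
        X (\prod_(a < k) x (tnth i a) - \prod_(a < k) x (tnth j a))
      & r = \prod_(a < k) x (tnth i a)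
            - (\prod_(a < k) x (tnth j a)) *~ signature (Defs.kernel i j)]].

Lemma cube_related (G : groupType) (g : 'I_N -> G) (X : set A) :
  generated_by_involutions g -> is_cube x g X ->
  forall k (i j : k.-tuple 'I_N), related g i j <->
    Pvert (Defs.kernel i j) /\
    X (\prod_(a < k) x (tnth i a) - \prod_(a < k) x (tnth j a)).
Proof.
move=> hg hX k i j; rewrite /related !prod_tnth.
have := @cube_word_eq _ _ _ _ hx _ _ _ i j hg hX.
by rewrite !size_tuple => /(_ erefl) h; split=> -[? /h].
Qed.

Lemma sphere_of_cube (G : groupType) (g : 'I_N -> G) (X : set A) :
  generated_by_involutions g -> is_cube x g X -> sphere_of X = sphere x g.
Proof.
move=> hg hX; congr zero_locus; apply/seteqP.
split=> r [k [i [j]]] => [[Pij Xij ->]|[/(cube_related hg hX)[Pij Xij] ->]].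
  by exists k, i, j; split=> //; apply/(cube_related hg hX).
by exists k, i, j.
Qed.

Lemma twisted_sphere_of_cube (G : groupType) (g : 'I_N -> G) (X : set A) :
  generated_by_involutions g -> is_cube x g X ->
  twisted_sphere_of X = twisted_sphere x g.
Proof.
move=> hg hX; congr zero_locus; apply/seteqP.
split=> r [k [i [j]]] => [[Pij Xij ->]|[/(cube_related hg hX)[Pij Xij] ->]].
  by exists k, i, j; split=> //; apply/(cube_related hg hX).
by exists k, i, j.
Qed.

Lemma cube_eq_intersection (G : groupType) (g : 'I_N -> G) (X : set A) :
  reflection_group g -> is_cube x g X -> intersection (sphere x g) free_cube = X.
Proof.
move=> hg hX; have gg : generated_by_involutions g by case: hg.
exact: (cube_unique hx gg (cube_of_sphere hg) hX).
Qed.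

End Spheres.

(** * The twisted spheres *)

Lemma F2_addb_neq0 (b : bool) (z : 'F_2) : (b%:R + z != 0) = b (+) (z != 0).
Proof. by case: b; case: z => [[|[|m]]] //= *; apply/eqP. Qed.

(** [chi b t] is the parity of the coordinates of index greater than [b] of the
    image of [t] in [Z_2^N].  Multiplication by [g a] flips the coordinate [a],
    so the operators with these signs anticommute for distinct indices, up to
    the action of the group. *)
Lemma signed_generators_exist (G : groupType) (N : nat) (g : 'I_N -> G) :
  reflection_group g -> exists chi : 'I_N -> G -> bool,
    forall a b t, chi b (g a * t)%g = chi b t (+) (b < a)%N.
Proof.
move=> [_ [q [qM _ qg]]].
exists (fun b t => \sum_(c : 'I_N | (b < c)%N) q t 0 c != 0) => a b t.
have -> : \sum_(c : 'I_N | (b < c)%N) q (g a * t)%g 0 c =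
    (b < a)%N%:R + \sum_(c : 'I_N | (b < c)%N) q t 0 c.
  under eq_bigr => c _ do rewrite qM qg mxE.
  rewrite big_split /=; congr (_ + _).
  have [ba|ab] := boolP (b < a)%N.
    rewrite (bigD1 a) //= mxE !eqxx big1 ?addr0 // => c /andP[_ ca].
    by rewrite mxE (negPf ca) andbF.
  rewrite big1 // => c bc; rewrite mxE; case: (c =P a) => [e|_]; last by rewrite andbF.
  by rewrite -e bc in ab.
by rewrite F2_addb_neq0 addbC.
Qed.

Lemma odd_sum_addb (T : Type) (w : seq T) (E F : T -> bool) :
  odd (\sum_(b <- w) (E b (+) F b)) = odd (\sum_(b <- w) E b + count F w).
Proof.
elim: w => [|b w IH]; first by rewrite !big_nil.
by rewrite !big_cons /=; move: IH; case: (E b); case: (F b); lia.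
Qed.

Section TwistedRepresentation.
Variables (R : realType) (N : nat) (G : groupType) (g : 'I_N -> G).
Hypothesis hg : reflection_group g.

(** The word [w] acts as [g_w] with a sign: the product of the signs of its
    letters, which does not depend on their order, times the parity of the
    number of inversions of [w]. *)
Lemma twisted_representation : exists (B : cstarType R) (U : 'I_N -> B),
  [/\ forall a, star (U a) = U a, forall a, U a * U a = 1,
      forall k (i j : k.-tuple 'I_N), related g i j ->
        \prod_(a <- i) U a =
          (-1) ^+ (inversions i + inversions j) * \prod_(a <- j) U a
    & forall (c : R[i]) (v w : seq 'I_N),
        \prod_(a <- v) U a = c *: \prod_(a <- w) U a ->
        (\prod_(a <- v) g a = \prod_(a <- w) g a)%g].
Proof.
have gg : generated_by_involutions g by case: hg.
have g2 a := generator_sq gg a.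
have [chi hchi] := signed_generators_exist hg.
have [B [M [MM M1 Ms MZ]]] := cstar_of_signed_perms R (1%g : G).
pose act (w : seq 'I_N) := fun t : G => ((\prod_(a <- w) g a) * t)%g.
have actK w : cancel (act w) (act (rev w)).
  move=> t; rewrite /act mulgA -(word_inv gg) mulVg; exact: mul1g.
have actVK w : cancel (act (rev w)) (act w) by move=> t; rewrite -{1}[w]revK actK.
pose sgn (w : seq 'I_N) := fun t : G => odd (\sum_(b <- w) chi b t + inversions w).
pose U a := M (chi a) (act [:: a]) (act [:: a]).
have act1 a t : act [:: a] t = (g a * t)%g by rewrite /act big_seq1.
have act_cons a w t : act (a :: w) t = (g a * act w t)%g.
  by rewrite /act big_cons mulgA.
have actD v w t : act (v ++ w) t = act v (act w t) by rewrite /act big_cat mulgA.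
have UW w : \prod_(a <- w) U a = M (sgn w) (act (rev w)) (act w).
  elim: w => [|a w IH].
    rewrite big_nil -[LHS](M1 false); congr (M _ _ _); apply/funext => t.
    - by rewrite /sgn big_nil.
    - by rewrite /act big_nil mul1g.
    - by rewrite /act big_nil mul1g.
  have aK : cancel (act [:: a]) (act [:: a]) by exact: (actK [:: a]).
  rewrite big_cons IH /U MM //; congr (M _ _ _); apply/funext => t.
  - rewrite /sgn act1 big_cons /=.
    under eq_bigr do rewrite hchi.
    rewrite oddD odd_sum_addb !oddD.
    by case: (chi a t); case: (odd _); case: (odd _); case: (odd _).
  - by rewrite rev_cons -cats1 actD.
  - by rewrite /= act1 act_cons.
have sK a : cancel (act [:: a]) (act [:: a]) := actK [:: a].
exists B, U; split=> [a|a|k i j /related_words[ij e]|c v w].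
- rewrite /U Ms //; congr (M _ _ _); apply/funext => t /=.
  by rewrite act1 hchi ltnn addbF.
- have := UW [:: a; a]; rewrite big_cons big_seq1 => ->.
  rewrite -[RHS](M1 false); congr (M _ _ _); apply/funext => t.
  + by rewrite /sgn !big_cons big_nil /= ltnn; case: (chi a t).
  + by rewrite !act_cons /act big_nil !mulgA g2 mulg1 mul1g.
  + by rewrite !act_cons /act big_nil !mulgA g2 mulg1 mul1g.
- rewrite !UW -signr_odd -M1 MM //; congr (M _ _ _); apply/funext => t /=.
  + by rewrite /sgn (perm_big j) //=; lia.
  + by rewrite /act -!(word_inv gg) e.
  + by rewrite /act e.
rewrite !UW => e.
have := MZ c _ _ _ _ _ _ (actVK v) (actK v) (actVK w) (actK w) e 1%g.
by rewrite /act !mulg1 -!(word_inv gg) => /invg_inj.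
Qed.

End TwistedRepresentation.

Section TwistedSpheres.
Variables (R : realType) (N : nat) (A : cstarType R) (x : 'I_N -> A).
Hypothesis hx : is_free_sphere x.
Local Notation rtN := (sqrtC N%:R : R[i]).

(** In the twisted representation of [H], the twisted relation of [(i, j)] forces
    [h_i = h_j]. *)
Lemma twisted_sphere_related (G H : groupType) (g : 'I_N -> G) (h : 'I_N -> H) :
  reflection_group h -> twisted_sphere x g `<=` twisted_sphere x h ->
  forall k (i j : k.-tuple 'I_N), related g i j -> related h i j.
Proof.
move=> hh gh k i j gij; have [ij _] := (related_words g i j).1 gij.
apply/related_words; split=> //.
have [B [U [sU UU Urel Uinj]]] := twisted_representation R hh.
have [f [hf fx _]] := free_sphere_map hx sU UU.
have fE n (v w : n.-tuple 'I_N) : perm_eq v w ->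
    f (\prod_(a < n) x (tnth v a)
       - (\prod_(a < n) x (tnth w a)) *~ signature (Defs.kernel v w)) =
    rtN^-1 ^+ n *: (\prod_(a <- v) U a
      - (-1) ^+ (inversions v + inversions w) * \prod_(a <- w) U a).
  move=> vw; rewrite !prod_tnth signature_kernel // -mulrzl rmorphXn rmorphN1 /=.
  have fN1 : f (-1) = -1 by rewrite -scaleN1r (star_homZ hf) (star_hom1 hf) scaleN1r.
  have fX m : f ((-1) ^+ m) = (-1) ^+ m.
    by elim: m => [|m IH]; rewrite ?expr0 ?(star_hom1 hf) // !exprS (star_homM hf) IH fN1.
  rewrite (star_homB hf) (star_homM hf) fX !(star_hom_word _ _ hf).
  under eq_bigr do rewrite fx; under [X in _ - _ * X]eq_bigr do rewrite fx.
  by rewrite !scale_word !size_tuple -scalerAr scalerBr.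
have ker a : twisted_sphere x h a -> f a = 0.
  apply: (star_hom_zero_locus hf) => _ [n [v [w [vw ->]]]].
  have [pvw _] := (related_words h v w).1 vw.
  by rewrite fE // (Urel _ _ _ vw) subrr scaler0.
have : f (\prod_(a < k) x (tnth i a)
       - (\prod_(a < k) x (tnth j a)) *~ signature (Defs.kernel i j)) = 0.
  apply: ker; apply: gh; apply: zero_locus_sub.
  by exists k, i, j.
rewrite fE // => /eqP; rewrite scaler_eq0 expf_eq0 invr_eq0.
rewrite (negPf (sqrt_rank_neq0 hx)) andbF /= subr_eq0 => /eqP e.
apply: (Uinj ((-1) ^+ (inversions i + inversions j))).
by rewrite e -(signr_odd B) -(signr_odd R[i]) mulr_sign scaler_sign.
Qed.

End TwistedSpheres.

Theorem proposition5p1 (R : realType) (N : nat) (A : cstarType R)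
    (x : 'I_N -> A) (hx : is_free_sphere x) :
  (exists (Z : set A) (F : set A -> set A),
     [/\ is_cube x (@Z2star_gen N) Z,
         set_bij (cubes x) (spheres x) F,
         forall (G : groupType) (g : 'I_N -> G) (X : set A),
           reflection_group g -> uniform g -> is_cube x g X ->
           F X = sphere x g,
         forall X : set A, cubes x X -> intersection (F X) Z = X
       & forall (G : groupType) (g : 'I_N -> G),
           reflection_group g -> uniform g ->
           is_cube x g (intersection (sphere x g) Z)]) /\
  (exists F : set A -> set A,
     set_bij (cubes x) (twisted_spheres x) F /\
     forall (G : groupType) (g : 'I_N -> G) (X : set A),
       reflection_group g -> uniform g -> is_cube x g X ->
       F X = twisted_sphere x g).
Proof.
have FE (G : groupType) (g : 'I_N -> G) (X : set A) : reflection_group g ->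
    is_cube x g X -> sphere_of x X = sphere x g.
  by case=> gg _; exact: sphere_of_cube.
have TE (G : groupType) (g : 'I_N -> G) (X : set A) : reflection_group g ->
    is_cube x g X -> twisted_sphere_of x X = twisted_sphere x g.
  by case=> gg _; exact: twisted_sphere_of_cube.
split.
  exists (free_cube x), (sphere_of x).
  have FK X : cubes x X -> intersection (sphere_of x X) (free_cube x) = X.
    by move=> [G [g [hg _ hX]]]; rewrite (FE _ _ _ hg hX) (cube_eq_intersection hx hg hX).
  split=> //; first exact: free_cubeP.
  - split=> [X [G [g [hg ug hX]]]|X Y /set_mem hX /set_mem hY e|_ [G [g [hg ug ->]]]].
    + by exists G, g; split=> //; exact: FE hg hX.
    + by rewrite -(FK X hX) e FK.
    + have hX := cube_of_sphere hx hg.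
      exists (intersection (sphere x g) (free_cube x)); last exact: FE hg hX.
      by exists G, g.
  - by move=> G g X hg _ hX; exact: FE hg hX.
  - by move=> G g hg _; exact: cube_of_sphere.
exists (twisted_sphere_of x); split; last by move=> G g X hg _ hX; exact: TE hg hX.
split=> [X [G [g [hg ug hX]]]|X Y|_ [G [g [hg ug ->]]]].
- by exists G, g; split=> //; exact: TE hg hX.
- move=> /set_mem[G [g [hg _ hX]]] /set_mem[H [h [hh _ hY]]].
  rewrite (TE _ _ _ hg hX) (TE _ _ _ hh hY) => e.
  rewrite -(cube_eq_intersection hx hg hX) -(cube_eq_intersection hx hh hY).
  congr (intersection (zero_locus _) _); apply/seteqP.
  split=> r [k [i [j [rel ->]]]]; exists k, i, j; split=> //.
    by apply: (twisted_sphere_related hx hh _ rel); rewrite e.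
  by apply: (twisted_sphere_related hx hg _ rel); rewrite e.
- have hX := cube_of_sphere hx hg.
  exists (intersection (sphere x g) (free_cube x)); last exact: TE hg hX.
  by exists G, g.
Qed.
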